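(* Let $X$ and $Y$ be bounded geometry metric spaces with property A. If the Roe algebras $C^*(X)$ and $C^*(Y)$ are $*$-isomorphic, then $X$ and $Y$ are coarsely equivalent.
   Context: A metric space $X$ has bounded geometry if for all $R\ge 0$ there is $N_R\in\mathbb{N}$ such that every ball of radius $R$ in $X$ has at most $N_R$ elements. A (not necessarily continuous) map $f:X\to Y$ of metric spaces is uniformly expansive if for all $R>0$ there is $S>0$ such that $d(x_1,x_2)\le R$ implies $d(f(x_1),f(x_2))\le S$. Two maps $f,g:X\to Y$ are close if there is $C>0$ with $d(f(x),g(x))\le C$ for all $x\in X$. $X$ and $Y$ are coarsely equivalent if there are uniformly expansive maps $f:X\to Y$ and $g:Y\to X$ such that $f\circ g$ and $g\circ f$ are close to the identity maps on $Y$ and $X$ respectively. Roe algebra: let $\mathcal{H}$ be a separable infinite dimensional complex Hilbert space. For a bounded operator $T$ on $l^2(X,\mathcal{H})\cong l^2(X)\otimes\mathcal{H}$ write $T_{xy}$ for its $(x,y)$ matrix coefficient, a bounded operator on $\mathcal{H}$. $T$ has finite propagation if there is $S>0$ such that $T_{xy}=0$ whenever $d(x,y)\ge S$. $\mathbb{C}[X]$ is the $*$-algebra of all finite propagation bounded operators $T$ on $l^2(X,\mathcal{H})$ such that every $T_{xy}$ is compact; $C^*(X)$ is its operator norm closure. Property A (Yu): for all $r>0$, $\epsilon>0$ there are finite subsets $A_x\subseteq X\times\mathbb{N}$ $(x\in X)$ with $(x,1)\in A_x$, with $|A_x\,\triangle\, A_{x'}|/|A_x\cap A_{x'}|<\epsilon$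 whenever $d(x,x')\le r$, and such that there is $R>0$ with $d(y,z)\le R$ whenever $(y,m),(z,n)\in A_x$ for some $x$. For bounded geometry metric spaces it is known to be equivalent to the metric sparsification property: there is a constant $0<\kappa\le 1$ such that for all $S\ge0$ there is $D\ge0$ such that for every Borel probability measure $\mu$ on $X$ there is a subset $\Omega=\sqcup_{i\in I}\Omega_i\subseteq X$ with $\mu(\Omega)\ge\kappa$, $\mathrm{diam}(\Omega_i)\le D$ for all $i$, and $d(\Omega_i,\Omega_j)>S$ for all $i\ne j$. *)

(* Defs.v *)
From HB Require Import structures.
From mathcomp Require Import all_boot all_order all_algebra finmap.
From mathcomp Require Import sesquilinear complex lra.
From mathcomp Require Import all_classical all_reals all_analysis.
From mathcomp Require showcase.summability.

Set Implicit Arguments.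
Unset Strict Implicit.
Unset Printing Implicit Defensive.

Import Order.TTheory GRing.Theory Num.Theory.
Import numFieldNormedType.Exports.

Local Open Scope classical_set_scope.
Local Open Scope ring_scope.
Local Open Scope complex_scope.

Section coarse_geometry.
Context {R : realType}.
Implicit Types X Y : metricType R.

Definition bounded_geometry X := forall r : R, 0 <= r ->
  exists N : nat, forall x : X, ([set y | mdist x y <= r] #<= `I_N)%card.

Definition uniformly_expansive X Y (f : X -> Y) := forall r : R, 0 < r ->
  exists2 s : R, 0 < s &
    forall x1 x2, mdist x1 x2 <= r -> mdist (f x1) (f x2) <= s.

Definition close_maps X Y (f g : X -> Y) :=
  exists2 c : R, 0 < c & forall x, mdist (f x) (g x) <= c.

Definition coarsely_equivalent X Y :=
  exists (f : X -> Y) (g : Y -> X),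
    [/\ uniformly_expansive f, uniformly_expansive g,
        close_maps (f \o g) idfun & close_maps (g \o f) idfun].

(* Since [x / 0 = 0] here, nonemptiness of the intersection has to be required
   explicitly for the quotient to be meaningful. *)
Definition property_A X := forall r eps : R, 0 < r -> 0 < eps ->
  exists A : X -> {fset X * nat},
    [/\ forall x, (x, 1%N) \in A x,
        forall x x', mdist x x' <= r ->
          (A x `&` A x' != fset0)%fset /\
          (#|` (A x `\` A x') `|` (A x' `\` A x)|%fset)%:R
            / (#|` A x `&` A x'|%fset)%:R < eps :> R &
        exists2 s : R, 0 < s & forall (x y z : X) (m n : nat),
          (y, m) \in A x -> (z, n) \in A x -> mdist y z <= s].

End coarse_geometry.

HB.mixin Record CompleteNormedModule_isHilbert (R : realType) H
    & CompleteNormedModule R[i] H := {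
  hdot : {dot H for @Num.conj R[i]} ;
  hdot_norm : forall v : H, hdot v v = `|v| ^+ 2 }.

(* complex Hilbert spaces; the inner product is linear on the left *)
#[short(type="hilbertType")]
HB.structure Definition Hilbert (R : realType) :=
  { H of CompleteNormedModule R[i] H & CompleteNormedModule_isHilbert R H }.

Section hilbert.
Context {R : realType} (H : hilbertType R).

Definition separable := exists2 D : set H, countable D & dense D.

Definition infinite_dimensional :=
  ~ exists (n : nat) (e : 'I_n -> H), forall v : H,
      exists c : 'I_n -> R[i], v = \sum_i c i *: e i.

Definition compact_operator (T : H -> H) :=
  linear T /\ compact (closure (T @` [set v | `|v| <= 1])).

End hilbert.

Section l2.
Context {R : realType} (X : choiceType) (H : hilbertType R).

(* The library norm of [H] takes its (real nonnegative) values in [R[i]]. *)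
Definition sqnorm (v : H) : R := complex.Re `|v| ^+ 2.

Definition sqsum (f : X -> H) : \bar R :=
  (\esum_(x in [set: X]) (sqnorm (f x))%:E)%E.

Definition square_summable : {pred X -> H} := fun f => (sqsum f < +oo)%E.

Record l2 := L2 { l2_fun :> X -> H ; _ : square_summable l2_fun }.

HB.instance Definition _ := [isSub for l2_fun].
HB.instance Definition _ := [Choice of l2 by <:].

Lemma normHE (v : H) : `|v| = (complex.Re `|v|)%:C.
Proof. by rewrite RRe_real// normr_real. Qed.

Lemma sqnorm_ge0 v : 0 <= sqnorm v.
Proof. exact: sqr_ge0. Qed.

Lemma sqnormZ a v : sqnorm (a *: v) = complex.Re `|a| ^+ 2 * sqnorm v.
Proof.
rewrite /sqnorm normrZ (normHE v) -[ `|a| ]RRe_real ?normr_real//.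
by rewrite -rmorphM/= exprMn.
Qed.

Lemma sqnormD_le u v : sqnorm (u + v) <= 2 * sqnorm u + 2 * sqnorm v.
Proof.
have /andP[_ +] : (complex.Im (`|u| + `|v|) == complex.Im `|u + v|) &&
    (complex.Re `|u + v| <= complex.Re (`|u| + `|v|)).
  by rewrite -lecE ler_normD.
have /andP[_] : (complex.Im `|u + v| == 0) && (0 <= complex.Re `|u + v|).
  by have := normr_ge0 (u + v); rewrite lecE.
rewrite raddfD /sqnorm /=; move: (complex.Re _) (complex.Re _) (complex.Re _).
move=> b a c c0 cab; apply: (@le_trans _ _ ((a + b) ^+ 2)).
  by rewrite ler_sqr ?nnegrE// (le_trans c0).
by have := sqr_ge0 (a - b); nra.
Qed.

Lemma square_summable_submod : submod_closed square_summable.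
Proof.
have sZ (c : R) f : 0 <= c -> square_summable f ->
    (\esum_(x in [set: X]) (c * sqnorm (f x))%:E < +oo)%E.
  move=> c0 sf; apply: (@le_lt_trans _ _ (c%:E * sqsum f)%E); last first.
    by rewrite lte_mul_pinfty.
  apply: ge_ereal_sup => _ [A [finA _] <-].
  under eq_fsbigr do rewrite EFinM.
  rewrite -ge0_mule_fsumr; last by move=> x; rewrite lee_fin sqnorm_ge0.
  by apply: lee_wpmul2l => //; apply: ereal_sup_ubound; exists A.
split.
  rewrite unfold_in /sqsum esum1// => x _.
  by rewrite /sqnorm normr0 expr0n.
move=> a f g sf sg; rewrite unfold_in.
apply: (@le_lt_trans _ _ (\esum_(x in [set: X])
   ((2 * complex.Re `|a| ^+ 2 * sqnorm (f x))%:E + (2 * sqnorm (g x))%:E))%E).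
  apply: le_esum => x _; rewrite -EFinD lee_fin.
  by rewrite (le_trans (sqnormD_le _ _))// sqnormZ mulrA.
have c0 : 0 <= 2 * complex.Re `|a| ^+ 2 by rewrite mulr_ge0 ?sqr_ge0.
by rewrite esumD ?lte_add_pinfty ?sZ// => x _;
  rewrite lee_fin mulr_ge0 ?sqnorm_ge0.
Qed.

HB.instance Definition _ :=
  GRing.isSubmodClosed.Build _ _ square_summable square_summable_submod.
HB.instance Definition _ := [SubChoice_isSubLmodule of l2 by <:].

Lemma single_square_summable (y : X) (v : H) :
  square_summable (fun x => if x == y then v else 0).
Proof.
rewrite /square_summable /sqsum.
rewrite (_ : (\esum_(x in _) _)%E = (sqnorm v)%:E) ?ltry//.
rewrite -(@esum_set1 _ _ y (fun=> (sqnorm v)%:E)) ?lee_fin ?sqnorm_ge0//.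
rewrite [RHS]esum_mkcond; apply: eq_esum => x _; rewrite in_set1.
by case: ifP => //; rewrite /sqnorm normr0 expr0n.
Qed.

Definition single (y : X) (v : H) : l2 := L2 (single_square_summable y v).

Definition l2norm (f : l2) : R := Num.sqrt (fine (sqsum f)).

(* [summability.sum] is the limit of the net of finite partial sums; it exists
   here because the family is absolutely summable (Cauchy-Schwarz). *)
Definition l2dot (f g : l2) : R[i] :=
  summability.sum (fun x => hdot (f x) (g x) : R[i]^o).

Definition bounded_operator (T : l2 -> l2) :=
  linear T /\ exists M : R, forall f, l2norm (T f) <= M * l2norm f.

Definition adjoint (T S : l2 -> l2) :=
  forall f g, l2dot (T f) g = l2dot f (S g).

Definition matrix_coef (T : l2 -> l2) (x y : X) (v : H) : H := T (single y v) x.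

End l2.

Section roe_algebra.
Context {R : realType} (X : metricType R) (H : hilbertType R).
Notation l2 := (l2 X H).

Definition finite_propagation (T : l2 -> l2) :=
  exists2 s : R, 0 < s &
    forall x y, s <= mdist x y -> matrix_coef T x y = (fun=> 0).

Definition algebraic_roe : set (l2 -> l2) :=
  [set T | [/\ bounded_operator T, finite_propagation T &
               forall x y, compact_operator (matrix_coef T x y)]].

(* closure of [algebraic_roe] for the operator norm *)
Definition roe : set (l2 -> l2) :=
  [set T | bounded_operator T /\
           forall eps : R, 0 < eps -> exists2 S, algebraic_roe S &
             forall f, l2norm (T f - S f) <= eps * l2norm f].

End roe_algebra.

Arguments algebraic_roe {R} X H.
Arguments roe {R} X H.

Section star_isomorphism.
Context {R : realType} (X Y : choiceType) (H K : hilbertType R).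

(* [A] and [B] are meant to be *-subalgebras of the bounded operators; only the
   values of [phi] on [A] matter. Adjoints of bounded operators are unique, so
   preserving the relation [adjoint] on [A] means preserving the involution. *)
Definition star_isomorphism (A : set (l2 X H -> l2 X H))
    (B : set (l2 Y K -> l2 Y K)) (phi : (l2 X H -> l2 X H) -> l2 Y K -> l2 Y K) :=
  [/\ set_bij A B phi,
      forall (a : R[i]) S T, A S -> A T ->
        phi (fun f => a *: S f + T f) = (fun g => a *: phi S g + phi T g),
      forall S T, A S -> A T -> phi (S \o T) = phi S \o phi T &
      forall S T, A S -> A T -> adjoint S T -> adjoint (phi S) (phi T)].

Definition star_isomorphic A B := exists phi, star_isomorphism A B phi.

End star_isomorphism.

(* Main.v *)
(* A *-isomorphism of Roe algebras is implemented by a unitary U, because they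
   contain all rank one operators.  Fix a unit vector h and let xi_x be the image
   under U of h placed at x.

   The point is that for d(x, x') <= r the vectors xi_x and xi_x' are almost
   entirely concentrated in one ball, whose radius depends only on r.  If not,
   there are escaping pairs (x_n, x'_n) violating this at radius n; after passing
   to a subsequence the xi_(x_n) hardly overlap.  The partial translation
   x_n |-> x'_n lies in the Roe algebra of X, so S = sum_n |xi'_n><xi_n| is close
   in norm to an operator of finite propagation on Y.  Property A of Y gives
   functions phi_i of uniformly bounded support for which the multiplier
   T |-> sum_i phi_i T phi_i is contractive and almost fixes that operator, hence
   S.  Testing S on (xi_n, xi'_n) gives
     1 - 6 e <= sum_(y, y') k(y, y') |xi_n(y)|^2 |xi'_n(y')|^2,
   where k = sum_i phi_i(y) phi_i(y') <= 1 vanishes for d(y, y') large.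

   Sending x to the centre of a ball carrying most of xi_x then gives a uniformly
   expansive map X -> Y.  For the composite with the map built from U^-1 one
   compares, on the X side, the unit vector at the centre y of that ball with the
   one at a nearby point y' pointing in the direction of xi_x(y'): the latter has
   mass bounded below at x.  The points y' escape because matrix coefficients are
   compact, so that xi_(x_n)(y') -> 0 in norm for fixed y'. *)

Require Import Defs.
From HB Require Import structures.
From mathcomp Require Import all_boot all_order all_algebra finmap.
From mathcomp Require Import sesquilinear complex lra.
From mathcomp Require Import all_classical all_reals all_analysis.
From mathcomp Require showcase.summability.

Set Implicit Arguments.
Unset Strict Implicit.
Unset Printing Implicit Defensive.

Import Order.TTheory GRing.Theory Num.Theory.
Import numFieldNormedType.Exports.

Local Open Scope classical_set_scope.
Local Open Scope ring_scope.
Local Open Scope complex_scope.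

#[local] Existing Instance summability.totally_filter.

(** * The inner product of square summable families *)

Section modulus.
Context {R : realType}.
Implicit Types z w : R[i].

(** The norm of [R[i]] takes its values in [R[i]]; this is the same modulus as an element of [R]. *)
Definition cmod z : R := complex.Re `|z|.

Lemma cmodE z : `|z| = (cmod z)%:C.
Proof. by rewrite /cmod RRe_real// normr_real. Qed.

Lemma cmod_ge0 z : 0 <= cmod z.
Proof. by have := normr_ge0 z; rewrite cmodE lecR. Qed.

Lemma cmodM z w : cmod (z * w) = cmod z * cmod w.
Proof.
have : `|z * w| = `|z| * `|w| by rewrite normrM.
by rewrite !cmodE -rmorphM => -[].
Qed.

Lemma cmodD z w : cmod (z + w) <= cmod z + cmod w.
Proof. by have := ler_normD z w; rewrite !cmodE -rmorphD lecR. Qed.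

Lemma cmod0 : cmod 0 = 0.
Proof. by rewrite /cmod normr0. Qed.

Lemma cmodR (a : R) : 0 <= a -> cmod a%:C = a.
Proof. by move=> a0; rewrite /cmod ger0_norm ?lecR. Qed.

Lemma cmod_conj z : cmod (conjc z) = cmod z.
Proof. by rewrite /cmod norm_conjC. Qed.

Lemma mulr_conj z : z * conjc z = (cmod z ^+ 2)%:C.
Proof. by rewrite -normCK cmodE rmorphXn. Qed.

Lemma Re_conjc z : complex.Re (conjc z) = complex.Re z.
Proof. by case: z. Qed.

Lemma Re_scale (a : R) z : complex.Re (a%:C * z) = a * complex.Re z.
Proof. by case: z => x y /=; rewrite mul0r subr0. Qed.

Lemma le_Re_cmod z : complex.Re z <= cmod z.
Proof.
apply: le_trans (ler_norm _) _.
by have := normc_ge_Re z; rewrite cmodE lecR.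
Qed.

Lemma cmod_le z : cmod z <= `|complex.Re z| + `|complex.Im z|.
Proof.
rewrite /cmod normc_def/= -[leRHS]ger0_norm ?addr_ge0// -sqrtr_sqr.
rewrite ler_wsqrtr// sqrrD !real_normK ?num_real// lerD2r lerDl.
by rewrite mulrn_wge0// mulr_ge0.
Qed.

Lemma cmod_sum (I : Type) (s : seq I) (P : pred I) (f : I -> R[i]) :
  cmod (\sum_(i <- s | P i) f i) <= \sum_(i <- s | P i) cmod (f i).
Proof.
elim/big_ind2: _ => [|x a y b xa yb|//]; first by rewrite cmod0.
by rewrite (le_trans (cmodD _ _))// lerD.
Qed.

End modulus.

Section dot_product.
Context {R : realType} (U : lmodType R[i]) (form : {dot U for @Num.conj R[i]}).
Implicit Types u v w : U.

Definition dotsq u : R := complex.Re (form u u).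

Lemma dotC u v : form u v = conjc (form v u).
Proof. by rewrite hermC expr0 mul1r. Qed.

Lemma dotDl u v w : form (u + v) w = form u w + form v w.
Proof. exact: linearDl. Qed.

Lemma dotDr u v w : form u (v + w) = form u v + form u w.
Proof. exact: linearDr. Qed.

Lemma dotBl u v w : form (u - v) w = form u w - form v w.
Proof. exact: linearBl. Qed.

Lemma dotBr u v w : form u (v - w) = form u v - form u w.
Proof. exact: linearBr. Qed.

Lemma dotZl a u v : form (a *: u) v = a * form u v.
Proof. exact: linearZl_LR. Qed.

Lemma dotZr a u v : form u (a *: v) = conjc a * form u v.
Proof. exact: linearZr_LR. Qed.

Lemma dot0l v : form 0 v = 0.
Proof. by have := dotZl 0 0 v; rewrite scale0r mul0r. Qed.

Lemma dot0r v : form v 0 = 0.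
Proof. by rewrite dotC dot0l conjc0. Qed.

Lemma dot_suml (I : Type) (s : seq I) (P : pred I) (f : I -> U) v :
  form (\sum_(i <- s | P i) f i) v = \sum_(i <- s | P i) form (f i) v.
Proof. exact: linear_sumlz. Qed.

Lemma dot_ge0 u : 0 <= form u u.
Proof.
by have [->|/neq0_dnorm_gt0/ltW] := eqVneq u 0; first by rewrite dot0l.
Qed.

Lemma dotE u : form u u = (dotsq u)%:C.
Proof. by rewrite /dotsq RRe_real// ger0_real// dot_ge0. Qed.

Lemma dotsq_ge0 u : 0 <= dotsq u.
Proof. by have := dot_ge0 u; rewrite dotE lecR. Qed.

Lemma dotsq_eq0 u : dotsq u = 0 -> u = 0.
Proof.
move=> u0; apply: contrapT => /eqP /(@neq0_dnorm_gt0 _ _ _ form).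
by rewrite dotE u0 ltxx.
Qed.

Lemma dotsqZ a u : dotsq (a *: u) = cmod a ^+ 2 * dotsq u.
Proof. by rewrite /dotsq dotZl dotZr mulrA mulr_conj Re_scale. Qed.

Lemma dotsqD u v : dotsq (u + v) = dotsq u + dotsq v + 2 * complex.Re (form u v).
Proof.
rewrite /dotsq dotDl !dotDr (dotC v u) !raddfD/= Re_conjc; lra.
Qed.

Lemma dotsqB u v : dotsq (u - v) = dotsq u + dotsq v - 2 * complex.Re (form u v).
Proof.
rewrite /dotsq dotBl !dotBr (dotC v u) !raddfB/= Re_conjc; lra.
Qed.

Lemma cauchy_schwarz u v : cmod (form u v) ^+ 2 <= dotsq u * dotsq v.
Proof.
have [v0|v0] := eqVneq (dotsq v) 0.
  by rewrite (dotsq_eq0 v0) dot0r cmod0 expr0n mulr_ge0// dotsq_ge0.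
have vp : 0 < dotsq v by rewrite lt_neqAle eq_sym v0 dotsq_ge0.
have := dotsq_ge0 ((dotsq v)%:C *: u - form u v *: v).
rewrite dotsqB !dotsqZ cmodR ?dotsq_ge0// dotZl dotZr.
rewrite [conjc _ * _]mulrC mulr_conj -rmorphM/=.
by move=> h; rewrite -(ler_pM2l vp); lra.
Qed.

(** An additive form of Cauchy-Schwarz with a free weight, which can be summed term by term; it
    comes from expanding the square of [u - t v]. *)
Lemma young u v (t : R) : 0 < t ->
  complex.Re (form u v) <= (dotsq u / t + t * dotsq v) / 2.
Proof.
move=> t0; have := dotsq_ge0 (u - t%:C *: v).
rewrite dotsqB dotsqZ cmodR ?(ltW t0)// dotZr. rewrite conjc_real Re_scale => h.
have tt : t * t^-1 = 1 by rewrite divff// gt_eqF.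
rewrite -(ler_pM2l t0).
rewrite (_ : t * ((dotsq u / t + t * dotsq v) / 2) =
  (dotsq u * (t * t^-1) + t * (t * dotsq v)) / 2); last by lra.
rewrite tt; lra.
Qed.

End dot_product.

Section finite_sums.
Context {R : realType} (X : choiceType).

Lemma ler_sum_fsubset (F G : {fset X}) (g : X -> R) : (forall x, 0 <= g x) ->
  (F `<=` G)%fset -> \sum_(x <- F) g x <= \sum_(x <- G) g x.
Proof.
move=> g0 FG; rewrite (big_fsetID _ [in F] G)/=.
have -> : [fset x in G | x \in F]%fset = F.
  by apply/fsetP => x; rewrite !inE/= andb_idl// => /(fsubsetP FG).
by rewrite lerDl sumr_ge0.
Qed.

Lemma esum_ubP (g : X -> R) (M : R) : (forall x, 0 <= g x) ->
  (forall F : {fset X}, \sum_(x <- F) g x <= M) ->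
  (\esum_(x in [set: X]) (g x)%:E <= M%:E)%E.
Proof.
move=> g0 gM; apply: ge_ereal_sup => _ [A [finA _] <-].
by rewrite fsbig_finite//= sumEFin lee_fin gM.
Qed.

Lemma sum_le_esum (g : X -> R) (F : {fset X}) : (forall x, 0 <= g x) ->
  ((\sum_(x <- F) g x)%:E <= \esum_(x in [set: X]) (g x)%:E)%E.
Proof.
move=> g0; apply: esum_ge; exists [set` F]; first by split => [|x _]; [exact: finite_fset|].
by rewrite -fsbig_seq ?fset_uniq//= sumEFin.
Qed.

Lemma esum_approx (g : X -> R) (e : R) : (forall x, 0 <= g x) -> 0 < e ->
  (\esum_(x in [set: X]) (g x)%:E < +oo)%E ->
  exists F : {fset X},
    fine (\esum_(x in [set: X]) (g x)%:E)%E - e < \sum_(x <- F) g x.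
Proof.
move=> g0 e0 goo; set s := (\esum_(x in _) _)%E in goo *.
have s0 : (0 <= s)%E by apply: esum_ge0 => x _; rewrite lee_fin.
have sfin : s \is a fin_num by rewrite ge0_fin_numE.
have := @ub_ereal_sup_adherent R [set (\sum_(x \in A) (g x)%:E)%E | A in fsets [set: X]] _ e0 sfin.
move=> [_ [A [finA _] <-]]; rewrite -/(esum _ _) -/s => h.
exists (fset_set A); rewrite -lte_fin EFinB fineK//.
by rewrite (lt_le_trans h)// fsbig_finite//= sumEFin.
Qed.

End finite_sums.

Section l2_sums.
Context {R : realType} (X : choiceType) (H : hilbertType R).
Notation l2 := (l2 X H).
Implicit Types f g : l2.

Definition l2sq f : R := fine (sqsum f).

Lemma l2P f : (sqsum f < +oo)%E.
Proof. by case: f. Qed.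

Lemma sqsumE f : sqsum f = (l2sq f)%:E.
Proof.
rewrite /l2sq fineK// ge0_fin_numE ?l2P//.
by apply: esum_ge0 => x _; rewrite lee_fin sqnorm_ge0.
Qed.

Lemma l2sq_ge0 f : 0 <= l2sq f.
Proof. by rewrite -lee_fin -sqsumE; apply: esum_ge0 => x _; rewrite lee_fin sqnorm_ge0. Qed.

Lemma sum_le_l2sq f (F : {fset X}) : \sum_(x <- F) sqnorm (f x) <= l2sq f.
Proof. by rewrite -lee_fin -sqsumE; apply: sum_le_esum => x; exact: sqnorm_ge0. Qed.

Lemma sqnorm_le_l2sq f x : sqnorm (f x) <= l2sq f.
Proof. by have := sum_le_l2sq f [fset x]%fset; rewrite big_seq_fset1. Qed.

Lemma l2sq_approx f (e : R) : 0 < e ->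
  exists F : {fset X}, l2sq f - e < \sum_(x <- F) sqnorm (f x).
Proof. by move=> e0; apply: esum_approx (l2P f) => // x; exact: sqnorm_ge0. Qed.

Lemma l2sq_le f (M : R) :
  (forall F : {fset X}, \sum_(x <- F) sqnorm (f x) <= M) -> l2sq f <= M.
Proof.
move=> fM; rewrite -lee_fin -sqsumE.
by apply: esum_ubP => // x; exact: sqnorm_ge0.
Qed.

Lemma square_summable_bounded (f : X -> H) (M : R) :
  (forall F : {fset X}, \sum_(x <- F) sqnorm (f x) <= M) -> @square_summable R X H f.
Proof.
move=> fM; apply: (@le_lt_trans _ _ M%:E); last by rewrite ltry.
by apply: esum_ubP => // x; exact: sqnorm_ge0.
Qed.

Lemma l2norm_sq f : l2norm f ^+ 2 = l2sq f.
Proof. by rewrite /l2norm sqr_sqrtr// l2sq_ge0. Qed.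

Lemma l2norm_ge0 f : 0 <= l2norm f.
Proof. exact: sqrtr_ge0. Qed.

Lemma l2_ext f g : (forall x, f x = g x) -> f = g.
Proof. by move=> fg; apply: val_inj; apply/funext. Qed.

Lemma l2D f g x : (f + g) x = f x + g x. Proof. by []. Qed.
Lemma l2N f x : (- f) x = - f x. Proof. by []. Qed.
Lemma l2Z (a : R[i]) f x : (a *: f) x = a *: f x. Proof. by []. Qed.
Lemma l2_0 x : (0 : l2) x = 0. Proof. by []. Qed.

End l2_sums.

Lemma cvg_complex {R : realType} (T : Type) (F : set_system T) {FF : Filter F}
    (u v : T -> R) (a b : R) :
  u x @[x --> F] --> a -> v x @[x --> F] --> b ->
  ((u x +i* v x)%C : R[i]^o) @[x --> F] --> ((a +i* b)%C : R[i]^o).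
Proof.
move=> /cvgrPdist_le ua /cvgrPdist_le vb; apply/cvgrPdist_le => -[e e'].
rewrite ltcE/= => /andP[/eqP -> {e'} e0].
have e20 : 0 < e / 2 by lra.
near=> x.
have ux : `|a - u x| <= e / 2 by near: x; exact: ua.
have vx : `|b - v x| <= e / 2 by near: x; exact: vb.
by rewrite cmodE lecR (le_trans (cmod_le _))//=; lra.
Unshelve. all: by end_near. Qed.

Lemma hdotE {R : realType} (H : hilbertType R) (v : H) : dotsq hdot v = sqnorm v.
Proof.
by rewrite /dotsq hdot_norm normHE -rmorphXn.
Qed.

Section l2_inner_product.
Context {R : realType} (X : choiceType) (H : hilbertType R).
Notation l2 := (l2 X H).
Notation totally := (@summability.totally X).
Implicit Types f g : l2.

Lemma totally_mono (u : {fset X} -> R) (l : R) :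
  (forall F G : {fset X}, (F `<=` G)%fset -> u F <= u G) ->
  (forall F, u F <= l) -> (forall e, 0 < e -> exists F, l - e < u F) ->
  u F @[F --> totally] --> l.
Proof.
move=> mono ub approx; apply/cvgrPdist_le => e e0.
have [F lF] := approx _ e0.
apply: (@filterS _ totally _ [set G | (F `<=` G)%fset]); last by exists F.
move=> G /= FG.
rewrite ger0_norm ?subr_ge0//.
by have := mono _ _ FG; lra.
Qed.

Lemma cvg_sqnorm f : \sum_(x <- F : {fset X}) sqnorm (f x) @[F --> totally] --> l2sq f.
Proof.
apply: totally_mono => [F G FG|F|e e0].
- by apply: ler_sum_fsubset => // x; exact: sqnorm_ge0.
- exact: sum_le_l2sq.
- exact: l2sq_approx.
Qed.

Lemma hdot_polarization (u v : H) : hdot u v =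
  ((sqnorm (u + v) - sqnorm u - sqnorm v) / 2 +i*
   ((sqnorm (u + 'i%C *: v) - sqnorm u - sqnorm v) / 2))%C.
Proof.
have cmod_i : cmod ('i%C : R[i]) = 1 by rewrite /cmod normc_def/= expr0n expr1n add0r sqrtr1.
rewrite -!hdotE !dotsqD dotsqZ cmod_i dotZr.
by case: (hdot u v) => a b; apply/eqP; rewrite eq_complex/=; apply/andP; split;
  apply/eqP; lra.
Qed.

(** Both components of the partial sums are combinations of partial sums of norm squares, which form
    bounded monotone nets. *)
Lemma cvg_polarization f g :
  (\sum_(x <- F : {fset X}) hdot (f x) (g x) : R[i]^o) @[F --> totally] -->
  (((l2sq (f + g) - l2sq f - l2sq g) / 2 +i*
    ((l2sq (f + 'i%C *: g) - l2sq f - l2sq g) / 2))%C : R[i]^o).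
Proof.
rewrite [X in fmap X _](_ : _ = (fun F : {fset X} =>
    ((\sum_(x <- F) sqnorm ((f + g) x) - \sum_(x <- F) sqnorm (f x)
      - \sum_(x <- F) sqnorm (g x)) / 2 +i*
     ((\sum_(x <- F) sqnorm ((f + 'i%C *: g) x) - \sum_(x <- F) sqnorm (f x)
      - \sum_(x <- F) sqnorm (g x)) / 2))%C : R[i]^o)).
  apply: cvg_complex; apply: cvgMr_tmp; apply: cvgB; try apply: cvgB;
    exact: cvg_sqnorm.
apply/funext => F; under eq_bigr do rewrite hdot_polarization.
rewrite -!sumrB !mulr_suml.
by elim/big_ind3: _ => // x1 a1 b1 x2 a2 b2 -> ->.
Qed.

Lemma l2dot_polarization f g : l2dot f g =
  ((l2sq (f + g) - l2sq f - l2sq g) / 2 +i*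
   ((l2sq (f + 'i%C *: g) - l2sq f - l2sq g) / 2))%C.
Proof.
rewrite /l2dot /summability.sum.
apply: (@cvg_lim R[i]^o); first exact: norm_hausdorff.
rewrite (_ : summability.partial_sum _ =
  fun F : {fset X} => (\sum_(x <- F) hdot (f x) (g x) : R[i]^o)).
  exact: cvg_polarization.
by apply/funext => F; rewrite /summability.partial_sum big_seq_fsetE.
Qed.

Lemma cvg_l2dot f g :
  (\sum_(x <- F : {fset X}) hdot (f x) (g x) : R[i]^o) @[F --> totally] --> (l2dot f g : R[i]^o).
Proof. by rewrite l2dot_polarization; exact: cvg_polarization. Qed.

Lemma l2dot_unique f g (l : R[i]) :
  (\sum_(x <- F : {fset X}) hdot (f x) (g x) : R[i]^o) @[F --> totally] --> (l : R[i]^o) ->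
  l2dot f g = l.
Proof.
move=> h; have := @cvg_l2dot f g.
move=> h'; exact: (@cvg_unique R[i]^o (@norm_hausdorff _ _) _ _ _ _ h' h).
Qed.

Lemma l2dot_linearl h : GRing.linear_for *%R ((@l2dot R X H)^~ h).
Proof.
move=> a f g; apply: l2dot_unique.
rewrite [X in fmap X _](_ : _ = (fun F : {fset X} =>
  a *: (\sum_(x <- F) hdot (f x) (h x) : R[i]^o) + \sum_(x <- F) hdot (g x) (h x))).
  by apply: cvgD; [apply: cvgZl_tmp|]; exact: cvg_l2dot.
apply/funext => F; rewrite scaler_sumr -big_split/=; apply: eq_bigr => x _.
by rewrite dotDl dotZl.
Qed.

Lemma l2dotC f g : l2dot f g = conjc (l2dot g f).
Proof.
apply: l2dot_unique.
rewrite [X in fmap X _](_ : _ = (fun F : {fset X} =>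
  conjc (\sum_(x <- F) hdot (g x) (f x)) : R[i]^o)); last first.
  apply/funext => F; rewrite rmorph_sum/=; apply: eq_bigr => x _; exact: dotC.
have /cvgrPdist_le gf := @cvg_l2dot g f.
apply/cvgrPdist_le => e /gf; apply: filterS => F /=.
by rewrite -rmorphB/= normcJ.
Qed.

Lemma l2dotE f : l2dot f f = (l2sq f)%:C.
Proof.
apply: l2dot_unique.
rewrite [X in fmap X _](_ : _ = (fun F : {fset X} =>
  ((\sum_(x <- F) sqnorm (f x)) +i* 0)%C : R[i]^o)).
  by apply: cvg_complex; [exact: cvg_sqnorm|exact: cvg_cst].
apply/funext => F; under eq_bigr do rewrite dotE hdotE.
by rewrite -rmorph_sum.
Qed.

Lemma l2sq_eq0 f : l2sq f = 0 -> f = 0.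
Proof.
move=> f0; apply: l2_ext => x; rewrite l2_0.
by apply: (@dotsq_eq0 _ _ hdot); apply: le_anti; rewrite dotsq_ge0 hdotE -f0 sqnorm_le_l2sq.
Qed.

Lemma l2dot_pos f : f != 0 -> 0 < l2dot f f.
Proof.
move=> f0; rewrite l2dotE ltcR lt_neqAle l2sq_ge0 andbT eq_sym.
by apply: contra_neq f0; exact: l2sq_eq0.
Qed.

Lemma l2dot_linearr h : GRing.linear_for (@Num.conj R[i] \; *%R) (@l2dot R X H h).
Proof.
by move=> a f g; rewrite l2dotC l2dot_linearl rmorphD rmorphM/= -!l2dotC.
Qed.

(** The instances declared here make the lemmas on a general [form], Cauchy-Schwarz included,
    available for [l2dot] as well as for [hdot]. *)
HB.instance Definition _ := bilinear_isBilinear.Build R[i] l2 l2 R[i]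
  *%R (@Num.conj R[i] \; *%R) (@l2dot R X H) (l2dot_linearl, l2dot_linearr).

Lemma l2dot_hermitian f g : l2dot f g = (-1) ^+ false * @Num.conj R[i] (l2dot g f).
Proof. by rewrite expr0 mul1r; exact: l2dotC. Qed.

HB.instance Definition _ := isHermitianSesquilinear.Build R[i] l2 false
  (@Num.conj R[i]) (@l2dot R X H) l2dot_hermitian.

HB.instance Definition _ := isDotProduct.Build R[i] l2 (@l2dot R X H) l2dot_pos.

Lemma l2dot_sq f : dotsq (@l2dot R X H) f = l2sq f.
Proof. by rewrite /dotsq/= l2dotE. Qed.

End l2_inner_product.

Section linear_maps.
Context {K : pzRingType} (U V : lmodType K) (T : U -> V).
Hypothesis linT : linear T.

Lemma lin0 : T 0 = 0.
Proof.
have := linT 1 0 0; rewrite !scale1r addr0 => h.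
by apply: (addrI (T 0)); rewrite addr0 -h.
Qed.

Lemma linD u v : T (u + v) = T u + T v.
Proof. by have := linT 1 u v; rewrite !scale1r. Qed.

Lemma linZ a u : T (a *: u) = a *: T u.
Proof. by have := linT a u 0; rewrite lin0 !addr0. Qed.

Lemma linB u v : T (u - v) = T u - T v.
Proof. by rewrite -scaleN1r linD linZ scaleN1r. Qed.

Lemma lin_sum (I : Type) (s : seq I) (P : pred I) (f : I -> U) :
  T (\sum_(i <- s | P i) f i) = \sum_(i <- s | P i) T (f i).
Proof. by apply: (big_morph T linD lin0). Qed.

End linear_maps.

(** * Finitely supported families and the norm of [l2] *)

Section finite_support.
Context {R : realType} (X : choiceType) (H : hilbertType R).
Notation l2 := (l2 X H).
Implicit Types (f g : l2) (F : {fset X}) (u : X -> H).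

Lemma singleE (y : X) (v : H) x : single y v x = if x == y then v else 0.
Proof. by []. Qed.

Lemma single_linear (y : X) : linear (single y : H -> l2).
Proof.
move=> a u v; apply: l2_ext => x; rewrite l2D l2Z !singleE.
by case: ifP => // _; rewrite scaler0 addr0.
Qed.

Lemma l2dot_single (y : X) (v : H) g : l2dot (single y v) g = hdot v (g y).
Proof.
apply: l2dot_unique; apply/cvgrPdist_le => e e0.
apply: (@filterS _ summability.totally _ [set F | ([fset y] `<=` F)%fset]); last first.
  by exists [fset y]%fset.
move=> F yF; have {}yF : y \in F by rewrite -fsub1set.
rewrite (big_fsetD1 y)// singleE eqxx big1_fset => [|x]; last first.
  by rewrite !inE singleE => /andP[/negPf -> _] _; rewrite dot0l.
by rewrite /= addr0 subrr normr0 ltW.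
Qed.

Lemma l2dot_singler (y : X) (v : H) f : l2dot f (single y v) = hdot (f y) v.
Proof. by rewrite l2dotC l2dot_single (dotC hdot v) conjcK. Qed.

Lemma l2_sum (I : Type) (s : seq I) (P : pred I) (f : I -> l2) x :
  (\sum_(i <- s | P i) f i) x = \sum_(i <- s | P i) f i x.
Proof. by elim/big_ind2: _ => // g a h b <- <-. Qed.

(** Truncation to a finite set, defined for an arbitrary function [u] so that rescaled families can
    be truncated without first being shown square summable. *)
Definition fsupp F u : l2 := \sum_(x <- F) single x (u x).

Lemma fsuppE F u x : fsupp F u x = if x \in F then u x else 0.
Proof.
rewrite /fsupp l2_sum; case: ifP => xF.
  rewrite (big_fsetD1 x)// singleE eqxx big1_fset => [|y]; first exact: addr0.
  by rewrite !inE singleE eq_sym => /andP[/negPf -> _].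
by rewrite big1_fset// => y yF _; rewrite singleE; case: eqP yF xF => // -> ->.
Qed.

Lemma l2dot_fsupp F u g : l2dot (fsupp F u) g = \sum_(x <- F) hdot (u x) (g x).
Proof. by rewrite dot_suml; apply: eq_bigr => x _; exact: l2dot_single. Qed.

Lemma l2sq_fsupp F u : l2sq (fsupp F u) = \sum_(x <- F) sqnorm (u x).
Proof.
rewrite -l2dot_sq /dotsq/= l2dot_fsupp raddf_sum/= big_seq [RHS]big_seq.
by apply: eq_bigr => x xF; rewrite fsuppE xF -hdotE.
Qed.

Lemma l2sq_single (y : X) (v : H) : l2sq (single y v) = sqnorm v.
Proof. by rewrite -l2dot_sq /dotsq/= l2dot_single singleE eqxx -hdotE. Qed.

Lemma l2sq_sub_fsupp F f :
  l2sq (f - fsupp F f) = l2sq f - \sum_(x <- F) sqnorm (f x).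
Proof.
rewrite -l2dot_sq dotsqB !l2dot_sq/= l2dotC Re_conjc l2dot_fsupp l2sq_fsupp raddf_sum/=.
under [X in 2 * X]eq_bigr do rewrite -/(dotsq hdot _) hdotE.
lra.
Qed.

Lemma fsupp_approx f (e : R) : 0 < e -> exists F, forall G, (F `<=` G)%fset ->
  l2sq (f - fsupp G f) < e.
Proof.
move=> e0; have [F fF] := l2sq_approx f e0; exists F => G FG.
rewrite l2sq_sub_fsupp.
by have := ler_sum_fsubset (fun x => sqnorm_ge0 (f x)) FG; lra.
Qed.

Lemma l2norm_le f g (c : R) : 0 <= c -> l2sq f <= c ^+ 2 * l2sq g ->
  l2norm f <= c * l2norm g.
Proof.
move=> c0; rewrite -!l2norm_sq -exprMn ler_sqr// nnegrE ?mulr_ge0 ?l2norm_ge0//.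
Qed.

Lemma l2sq_le_norm f g (c : R) : 0 <= c -> l2norm f <= c * l2norm g ->
  l2sq f <= c ^+ 2 * l2sq g.
Proof.
move=> c0; rewrite -!l2norm_sq -exprMn ler_sqr// nnegrE ?mulr_ge0 ?l2norm_ge0//.
Qed.

Lemma l2norm_cauchy f g : cmod (l2dot f g) <= l2norm f * l2norm g.
Proof.
rewrite -ler_sqr ?nnegrE ?cmod_ge0 ?mulr_ge0 ?l2norm_ge0// exprMn !l2norm_sq.
by rewrite -!l2dot_sq; exact: cauchy_schwarz.
Qed.

Lemma l2normD f g : l2norm (f + g) <= l2norm f + l2norm g.
Proof.
rewrite -ler_sqr ?nnegrE ?addr_ge0 ?l2norm_ge0// l2norm_sq sqrrD !l2norm_sq.
rewrite -l2dot_sq dotsqD !l2dot_sq/=.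
have := le_trans (le_Re_cmod _) (l2norm_cauchy f g); lra.
Qed.

Lemma l2normZ (a : R[i]) f : l2norm (a *: f) = cmod a * l2norm f.
Proof.
apply/eqP; rewrite -(@eqrXn2 _ 2) ?mulr_ge0 ?cmod_ge0 ?l2norm_ge0//.
by rewrite exprMn !l2norm_sq -!l2dot_sq dotsqZ.
Qed.

End finite_support.

(** * Operators in the Roe algebra *)

Section rank_one.
Context {R : realType} (H : hilbertType R).

(** The unit ball is mapped into the multiples of [a] by scalars from a square of the complex plane,
    which form a compact set. *)
Lemma compact_rank_one (a b : H) : compact_operator (fun v => hdot v b *: a).
Proof.
split; first by move=> c u v; rewrite dotDl dotZl scalerDl scalerA.
(* This bounds the norm of [b] without a square root, since a number is at most one plus its
   square. *)
pose M := 1 + sqnorm b.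
pose K := (fun p : R * R => ((p.1 +i* p.2)%C : R[i]^o) *: a) @`
  (`[- M, M] `*` `[- M, M]).
have cK : compact K.
  apply: continuous_compact; last first.
    by apply: compact_setX; exact: segment_compact.
  apply: continuous_subspaceT => p; apply: cvgZr_tmp; apply: cvg_complex.
    exact: cvg_fst.
  exact: cvg_snd.
apply: (subclosed_compact (@closed_closure _ _) cK).
have KH : closed K by apply: compact_closed cK; exact: norm_hausdorff.
rewrite [X in _ `<=` X](closure_id K).1//; apply: closure_subset.
move=> _ [v v1 <-].
have sv : sqnorm v <= 1.
  rewrite /sqnorm; have : (0 : R) <= complex.Re `|v|.
    by have := normr_ge0 v; rewrite normHE lecR.
  by move: v1; rewrite /= normHE lecR => *; rewrite exprn_ile1.
have cM : cmod (hdot v b) <= M.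
  rewrite -ler_sqr ?nnegrE ?cmod_ge0 ?addr_ge0 ?sqnorm_ge0//.
  apply: le_trans (cauchy_schwarz _ _ _) _; rewrite !hdotE /M.
  by have := sqnorm_ge0 b; have := sqnorm_ge0 v; nra.
have [cR cI] : `|complex.Re (hdot v b)| <= cmod (hdot v b) /\
               `|complex.Im (hdot v b)| <= cmod (hdot v b).
  by rewrite /cmod normc_def/= -!sqrtr_sqr !ler_wsqrtr ?lerDl ?lerDr ?sqr_ge0.
exists (complex.Re (hdot v b), complex.Im (hdot v b)).
  by split => /=; rewrite in_itv/= -ler_norml (le_trans _ cM).
by case: (hdot v b).
Qed.

End rank_one.

Section partial_translation.
Context {R : realType} (X : metricType R) (H : hilbertType R) (J : choiceType).
Notation l2 := (l2 X H).

(* The operator [\sum_j single z_j (v' j) <., single (xs j) (v j)>], where [k]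
   is the partial inverse of [j |-> z_j]; it is [0] on the junk case where the
   image is not square summable. *)
Definition transl_fun (k : X -> option J) (xs : J -> X) (v v' : J -> H)
    (f : X -> H) : X -> H :=
  fun z => oapp (fun j => hdot (f (xs j)) (v j) *: v' j) 0 (k z).

Definition transl k xs v v' (f : l2) : l2 := insubd 0 (transl_fun k xs v v' f).

Definition transl_data (k : X -> option J) (xs : J -> X) (v v' : J -> H) :=
  [/\ forall z z' j, k z = Some j -> k z' = Some j -> z = z', injective xs,
      forall j, sqnorm (v j) <= 1 & forall j, sqnorm (v' j) <= 1].

(** By induction on [Z]: as [k] is injective where it is defined, a new point contributes either
    nothing or an index not yet in [K]. *)
Lemma sum_option (k : X -> option J) (Z : {fset X}) :
  (forall z z' j, k z = Some j -> k z' = Some j -> z = z') ->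
  exists2 K : {fset J},
  (forall j, j \in K -> exists2 z, z \in Z & k z = Some j) &
  forall g : J -> R, \sum_(z <- Z) oapp g 0 (k z) = \sum_(j <- K) g j.
Proof.
move=> k_inj; elim/fset1U_rect: Z => [|z Z zZ [K KZ eK]].
  by exists fset0 => [j|g]; rewrite ?inE ?big_seq_fset0.
case kz: (k z) => [j|]; last first.
  exists K => [j /KZ[z' z'Z kz']|g]; last by rewrite big_fsetU1//= kz eK add0r.
  by exists z' => //; rewrite !inE z'Z orbT.
exists (j |` K)%fset => [i|g]; last first.
  rewrite !big_fsetU1//= ?kz ?eK//; apply/negP => /KZ[z' z'Z /(k_inj _ _ _ kz) zz'].
  by rewrite zz' z'Z in zZ.
rewrite !inE => /orP[/eqP ->|/KZ[z' z'Z kz']]; first by exists z; rewrite ?inE ?eqxx.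
by exists z' => //; rewrite !inE z'Z orbT.
Qed.

Variables (k : X -> option J) (xs : J -> X) (v v' : J -> H).
Hypothesis D : transl_data k xs v v'.

(** The set [K] is fixed before [f], so that in [cross_terms] one index set serves all localized
    pieces of a vector. *)
Lemma sum_transl_fun (Z : {fset X}) : exists2 K : {fset J},
  (forall j, j \in K -> exists2 z, z \in Z & k z = Some j) &
  forall f : l2, \sum_(z <- Z) sqnorm (transl_fun k xs v v' f z) <=
  \sum_(j <- K) cmod (hdot (f (xs j)) (v j)) ^+ 2.
Proof.
have [k_inj _ _ v'1] := D.
have [K KZ eK] := sum_option Z k_inj.
exists K => // f; rewrite -eK; apply: ler_sum => z _; rewrite /transl_fun.
case: (k z) => [j|]/=; last by rewrite /sqnorm normr0 expr0n.
rewrite -hdotE dotsqZ hdotE; have := v'1 j; have := sqr_ge0 (cmod (hdot (f (xs j)) (v j))).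
nra.
Qed.

Lemma sum_transl_fun_le (f : l2) (Z : {fset X}) :
  \sum_(z <- Z) sqnorm (transl_fun k xs v v' f z) <= l2sq f.
Proof.
have [_ xs_inj v1 _] := D.
have [K _ /(_ f)/le_trans] := sum_transl_fun Z; apply.
apply: (@le_trans _ _ (\sum_(j <- K) sqnorm (f (xs j)))).
  apply: ler_sum => j _; apply: le_trans (cauchy_schwarz _ _ _) _.
  by rewrite !hdotE; have := v1 j; have := sqnorm_ge0 (f (xs j)); nra.
rewrite (_ : \sum_(j <- K) _ =
    \sum_(x <- [fset xs j | j in K]%fset) sqnorm (f x)); last first.
  by rewrite big_imfset//= => ? ? _ _ /xs_inj.
exact: sum_le_l2sq.
Qed.

Lemma translE f : transl k xs v v' f = transl_fun k xs v v' f :> (X -> H).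
Proof.
rewrite /transl val_insubd ifT//.
exact: square_summable_bounded (sum_transl_fun_le f).
Qed.

Lemma l2sq_transl f : l2sq (transl k xs v v' f) <= l2sq f.
Proof. by apply: l2sq_le => Z; rewrite translE; exact: sum_transl_fun_le. Qed.

Lemma transl_linear : linear (transl k xs v v').
Proof.
move=> a f g; apply: l2_ext => z; rewrite l2D l2Z !translE /transl_fun.
case: (k z) => [j|]/=; last by rewrite scaler0 addr0.
by rewrite dotDl dotZl scalerDl scalerA.
Qed.

Lemma transl_bounded : bounded_operator (transl k xs v v').
Proof.
split; first exact: transl_linear.
by exists 1 => f; apply: l2norm_le; rewrite ?ler01// expr1n mul1r l2sq_transl.
Qed.

Lemma transl_roe (r : R) : (forall z j, k z = Some j -> mdist z (xs j) <= r) ->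
  algebraic_roe X H (transl k xs v v').
Proof.
move=> kr; have [_ xs_inj _ _] := D; split; first exact: transl_bounded.
  (* [finite_propagation] wants a positive bound and vanishing already at that distance, hence the
     absolute value and the added [1]. *)
  exists (`|r| + 1); first by rewrite ltr_wpDl.
  move=> x y rxy; apply/funext => u; rewrite /matrix_coef translE /transl_fun.
  case kx: (k x) => [j|]//=; case: eqP => [xy|_]; last by rewrite dot0l scale0r.
  exfalso; have := kr _ _ kx; rewrite xy; have := ler_norm r; lra.
move=> x y; rewrite /matrix_coef.
case kx: (k x) => [j|]; last first.
  rewrite (_ : (fun _ => _) = fun u => hdot u 0 *: 0); first exact: compact_rank_one.
  by apply/funext => u; rewrite translE /transl_fun kx/= scaler0.
have [xy|xy] := eqVneq (xs j) y.
  rewrite (_ : (fun _ => _) = fun u => hdot u (v j) *: v' j); first exact: compact_rank_one.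
  by apply/funext => u; rewrite translE /transl_fun kx/= xy eqxx.
rewrite (_ : (fun _ => _) = fun u => hdot u 0 *: 0); first exact: compact_rank_one.
by apply/funext => u; rewrite translE /transl_fun kx/= (negPf xy) dot0l scale0r scaler0.
Qed.

End partial_translation.

Section rank_one_operator.
Context {R : realType} (X : metricType R) (H : hilbertType R).
Notation l2 := (l2 X H).
Implicit Types (f g xi eta : l2).

(** The rank one operator |xi><eta|. *)
Definition ketbra xi eta f : l2 := l2dot f eta *: xi.

Lemma ketbra_linear xi eta : linear (ketbra xi eta).
Proof. by move=> a f g; rewrite /ketbra dotDl dotZl scalerDl scalerA. Qed.

Lemma ketbra_norm xi eta f :
  l2norm (ketbra xi eta f) <= l2norm xi * l2norm eta * l2norm f.
Proof.
rewrite l2normZ; have := l2norm_cauchy f eta; have := l2norm_ge0 xi; nra.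
Qed.

Lemma ketbra_bounded xi eta : bounded_operator (ketbra xi eta).
Proof.
split; first exact: ketbra_linear.
by exists (l2norm xi * l2norm eta) => f; exact: ketbra_norm.
Qed.

Lemma adjoint_ketbra xi eta : adjoint (ketbra xi eta) (ketbra eta xi).
Proof.
by move=> f g; rewrite /ketbra dotZl dotZr [l2dot g xi]l2dotC conjcK mulrC.
Qed.

Lemma ketbra_alg_roe (F G : {fset X}) u w :
  algebraic_roe X H (ketbra (fsupp F u) (fsupp G w)).
Proof.
split; first exact: ketbra_bounded.
  (* The sum of all distances between the two supports bounds each of them; the added [1] gives
     positivity and a strict inequality. *)
  exists (1 + \sum_(x <- F) \sum_(y <- G) mdist x y).
    by rewrite ltr_wpDr// sumr_ge0// => x _; rewrite sumr_ge0// => y _; exact: mdist_ge0.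
  move=> x y d; apply/funext => z; rewrite /matrix_coef /ketbra l2dot_single l2Z !fsuppE.
  case: ifP => yG; last by rewrite dot0r scale0r.
  case: ifP => xF; last by rewrite scaler0.
  exfalso.
  suff : mdist x y <= \sum_(x <- F) \sum_(y <- G) mdist x y by lra.
  rewrite (big_fsetD1 x)//= (big_fsetD1 y)//= -addrA lerDl addr_ge0//.
    by rewrite sumr_ge0// => *; exact: mdist_ge0.
  by rewrite sumr_ge0// => *; rewrite sumr_ge0// => *; exact: mdist_ge0.
move=> x y; rewrite (_ : matrix_coef _ x y = fun z => hdot z (fsupp G w y) *: fsupp F u x).
  exact: compact_rank_one.
by apply/funext => z; rewrite /matrix_coef /ketbra l2dot_single.
Qed.

Lemma l2norm_approx f (e : R) : 0 < e -> exists F : {fset X}, l2norm (f - fsupp F f) < e.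
Proof.
move=> e0; have [F /(_ F (fsubset_refl _)) h] := fsupp_approx f (exprn_gt0 2 e0).
by exists F; rewrite -ltr_sqr ?nnegrE ?l2norm_ge0 ?ltW// l2norm_sq.
Qed.

Lemma ketbra_roe xi eta : roe X H (ketbra xi eta).
Proof.
split; first exact: ketbra_bounded.
move=> e e0.
(* Truncating both vectors up to [d] costs at most [d * l2norm eta + (l2norm xi + 1) * d], which is
   [d * c]; the bound [d <= 1] keeps the truncation of [xi] below norm [l2norm xi + 1]. *)
pose c := l2norm xi + l2norm eta + 1.
have cp : 0 < c by rewrite ltr_wpDl ?addr_ge0 ?l2norm_ge0.
pose d := Num.min 1 (e / (2 * c)).
have d0 : 0 < d by rewrite lt_min ltr01 divr_gt0// mulr_gt0.
have d1 : d <= 1 by rewrite ge_min lexx.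
have dc : d * c <= e / 2.
  have : d <= e / (2 * c) by rewrite ge_min lexx orbT.
  by rewrite ler_pdivlMr ?mulr_gt0//; lra.
have [F Fxi] := l2norm_approx xi d0; have [G Geta] := l2norm_approx eta d0.
exists (ketbra (fsupp F xi) (fsupp G eta)); first exact: ketbra_alg_roe.
move=> f; set x := fsupp F xi in Fxi *; set y := fsupp G eta in Geta *.
have -> : ketbra xi eta f - ketbra x y f = ketbra (xi - x) eta f + ketbra x (eta - y) f.
  by rewrite /ketbra dotBr scalerBl scalerBr addrA subrK.
apply: le_trans (l2normD _ _) _.
have xn : l2norm x <= l2norm xi + 1.
  have -> : x = xi + (-1) *: (xi - x) by rewrite scaleN1r opprB addrC subrK.
  apply: le_trans (l2normD _ _) _; rewrite l2normZ /cmod normrN1/= mul1r lerD2l.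
  lra.
have := ketbra_norm (xi - x) eta f; have := ketbra_norm x (eta - y) f.
have := l2norm_ge0 f; have := l2norm_ge0 eta; have := l2norm_ge0 x.
have := l2norm_ge0 xi; have := l2norm_ge0 (xi - x); have := l2norm_ge0 (eta - y).
set a := l2norm (xi - x) in Fxi *; set b := l2norm (eta - y) in Geta *.
set n := l2norm f => b0 a0 xi0 x0 eta0 n0 h1 h2.
apply: le_trans (lerD h2 h1) _; rewrite -mulrDl ler_wpM2r//.
apply: (@le_trans _ _ (d * l2norm eta + (l2norm xi + 1) * d)); last by rewrite /c in dc; nra.
by rewrite lerD// ?ler_wpM2r// ?ler_pM// ltW.
Qed.

Lemma algebraic_roe_roe (T : l2 -> l2) : algebraic_roe X H T -> roe X H T.
Proof.
move=> TR; split; first by case: TR.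
move=> e e0; exists T => // f; rewrite subrr.
by rewrite -(scale0r 0) l2normZ cmod0 mul0r mulr_ge0 ?l2norm_ge0 ?ltW.
Qed.

End rank_one_operator.

(** * Spatial implementation of isomorphisms *)

Section spatial_implementation.
Context {R : realType} (H : hilbertType R).

(** Only one inclusion between the Roe algebras is recorded; the reverse one is
    [roe_unitary V U]. *)
Definition roe_unitary (X Y : metricType R) (U : l2 X H -> l2 Y H)
    (V : l2 Y H -> l2 X H) :=
  [/\ linear U, cancel U V, cancel V U,
      forall f g, l2dot (U f) (U g) = l2dot f g &
      forall T, roe X H T -> roe Y H (U \o T \o V)].

Lemma l2_normalize (X : choiceType) (f : l2 X H) : f != 0 ->
  exists c : R[i], l2dot (c *: f) (c *: f) = 1.
Proof.
move=> f0; exists ((l2norm f)^-1)%:C.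
have n0 : l2norm f != 0.
  by apply: contra_neq f0 => fn; apply: l2sq_eq0; rewrite -l2norm_sq fn expr0n.
rewrite l2dotE -l2norm_sq l2normZ cmodR ?invr_ge0 ?l2norm_ge0// mulVf// expr1n.
by [].
Qed.

(** The image [q] of the projection |xi0><xi0| is a nonzero idempotent. Fix a unit vector [eta0] in
    its range and send [xi] to the value at [eta0] of the image of |xi><xi0|. This is isometric
    because |xi0><f| composed with |g><xi0| is <g, f> |xi0><xi0|, and it intertwines [T] with
    [phi T] because [T] maps |f><xi0| to |T f><xi0|. *)
Lemma star_isomorphism_spatial (X Y : metricType R) (x0 : X) (h0 : H) :
  sqnorm h0 = 1 -> star_isomorphic (roe X H) (roe Y H) ->
  exists (U : l2 X H -> l2 Y H) (V : l2 Y H -> l2 X H),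
    roe_unitary U V /\ roe_unitary V U.
Proof.
move=> h01 [phi [[phiR phi_inj phi_surj] phi_lin phi_mul phi_adj]].
pose xi0 := single x0 h0 : l2 X H.
have xi01 : l2dot xi0 xi0 = 1 by rewrite l2dotE l2sq_single h01.
pose t xi := ketbra xi xi0.
have tR xi : roe X H (t xi) by exact: ketbra_roe.
have phi0 g : phi (t 0) g = 0.
  have t0 : (fun f => 1 *: t 0 f + t 0 f) = t 0.
    by apply/funext => f; rewrite /t /ketbra !scaler0 addr0.
  have := phi_lin 1 _ _ (tR 0) (tR 0); rewrite t0 => /(congr1 (@^~ g)) /=.
  by rewrite scale1r => e; apply: (addrI (phi (t 0) g)); rewrite addr0 -e.
pose q := phi (t xi0).
have q_lin : linear q by case: (phiR _ (tR xi0)) => -[].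
have qq f : q (q f) = q f.
  have tt : t xi0 \o t xi0 = t xi0.
    by apply/funext => g; rewrite /t /ketbra/= dotZl/= xi01 mulr1.
  by have := phi_mul _ _ (tR xi0) (tR xi0); rewrite tt => /(congr1 (@^~ f)).
have [z qz] : exists z, q z != 0.
  apply: contrapT => /forallNP q0.
  have : t xi0 = t 0.
    apply: phi_inj; rewrite ?inE//; apply/funext => g; rewrite phi0.
    by have /negP := q0 g; rewrite negbK => /eqP.
  move=> /(congr1 (fun T => T xi0)); rewrite /t /ketbra xi01 scaler0 scale1r => x00.
  by move: xi01; rewrite x00 dot0l => /esym/eqP; rewrite oner_eq0.
have [c c1] := l2_normalize qz.
pose eta0 := c *: q z; rewrite -/eta0 in c1.
have q_eta0 : q eta0 = eta0 by rewrite (linZ q_lin) qq.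
pose U xi := phi (t xi) eta0.
have U_lin : linear U.
  move=> a u v; rewrite /U -[RHS]/((fun g => a *: phi (t u) g + phi (t v) g) eta0).
  rewrite -phi_lin//; congr (phi _ _); apply/funext => f.
  by rewrite /t /ketbra scalerDr !scalerA mulrC.
have U_xi0 : U xi0 = eta0 by exact: q_eta0.
have U_iso f g : l2dot (U f) (U g) = l2dot f g.
  rewrite /U (phi_adj (t f) (ketbra xi0 f))//; last 2 first.
  - exact: ketbra_roe.
  - exact: adjoint_ketbra.
  rewrite -[phi _ (phi _ _)]/((phi (ketbra xi0 f) \o phi (t g)) eta0).
  rewrite -(phi_mul _ _ (ketbra_roe _ _) (tR g)).
  rewrite (_ : _ \o _ = t (l2dot g f *: xi0)); last first.
    by apply/funext => h; rewrite /t /ketbra/= dotZl scalerA.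
  by rewrite -/(U _) (linZ U_lin) U_xi0 dotZr/= c1 mulr1 -l2dotC.
have U_phi T f : roe X H T -> phi T (U f) = U (T f).
  move=> TR; have T_lin : linear T by case: TR => -[].
  rewrite /U -[LHS]/((phi T \o phi (t f)) eta0) -(phi_mul _ _ TR (tR f)).
  by congr (phi _ _); apply/funext => g; rewrite /t /ketbra/= (linZ T_lin).
have U_surj g : exists f, U f = g.
  (* If [phi T] is |g><eta0|, then [U (T xi0)] is [phi T eta0], which is [g]. *)
  have [T TR phiT] := phi_surj _ (ketbra_roe g eta0).
  by exists (T xi0); rewrite -(U_phi _ _ TR) phiT U_xi0 /ketbra c1 scale1r.
have U_inj f g : U f = U g -> f = g.
  move=> fg; apply/eqP; rewrite -subr_eq0; apply/eqP/l2sq_eq0.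
  rewrite -l2dot_sq /dotsq/= -U_iso (linB U_lin) fg subrr dot0l.
  by [].
have [V UV] := choice U_surj.
have VU : cancel U V by move=> f; apply: U_inj; rewrite UV.
exists U, V; split; split.
- exact: U_lin.
- exact: VU.
- exact: UV.
- exact: U_iso.
- move=> T TR; rewrite (_ : U \o T \o V = phi T); first exact: phiR.
  by apply/funext => g /=; rewrite -(U_phi _ _ TR) UV.
- by move=> a u v; apply: U_inj; rewrite U_lin !UV.
- exact: UV.
- exact: VU.
- by move=> f g; rewrite -U_iso !UV.
- move=> S SR; have [T TR <-] := phi_surj _ SR.
  rewrite (_ : V \o phi T \o U = T); first exact: TR.
  by apply/funext => f /=; rewrite (U_phi _ _ TR) VU.
Qed.

(** Over an empty [X] the space [l2] has one point, so all operators on it coincide and |e><e| would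
    have the same preimage as zero. *)
Lemma star_isomorphic_nonempty (X Y : metricType R) (h0 : H) :
  sqnorm h0 = 1 -> star_isomorphic (roe X H) (roe Y H) -> Y -> inhabited X.
Proof.
move=> h01 [phi [[phiR phi_inj phi_surj] _ _ _]] y0.
apply: contrapT => X0.
pose e := single y0 h0 : l2 Y H.
have [S SR phiS] := phi_surj _ (ketbra_roe e e).
have [T TR phiT] := phi_surj _ (ketbra_roe (0 : l2 Y H) e).
have ST : S = T.
  apply/funext => f; apply: l2_ext => x; exfalso; apply: X0; exact: inhabits x.
have := congr1 (@^~ e) (etrans (esym phiS) (etrans (congr1 phi ST) phiT)).
have e1 : l2dot e e = 1 by rewrite l2dotE l2sq_single h01.
rewrite /ketbra e1 !scale1r => e0.
by move: e1; rewrite e0 dot0l => /esym/eqP; rewrite oner_eq0.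
Qed.

End spatial_implementation.

(** * Partitions from property A *)

Section bounded_geometry_property_A.
Context {R : realType} (Y : metricType R).

Lemma bounded_geometry_fset (r : R) : bounded_geometry Y -> 0 <= r ->
  exists N : nat, forall y : Y, exists2 G : {fset Y}, (#|` G| <= N)%N &
    forall z, (z \in G) = (mdist y z <= r).
Proof.
move=> bg r0; have [N NP] := bg _ r0; exists N => y.
have finB : finite_set [set z | mdist y z <= r].
  exact: card_le_finite (NP y) (finite_II N).
exists (fset_set [set z | mdist y z <= r]).
  have := NP y; rewrite -{1}(fset_setK finB).
  by rewrite (card_le_eql (introT card_eq_fsetP (erefl _))) card_le_II.
by move=> z; rewrite in_fset_set//; apply/idP/idP; rewrite inE.
Qed.

Lemma bounded_geometry_sum (r : R) : bounded_geometry Y -> 0 <= r ->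
  exists N : nat, forall (F : {fset Y}) (y : Y) (c : R), 0 <= c ->
    \sum_(z <- F | mdist y z <= r) c <= N%:R * c.
Proof.
move=> bg r0; have [N NP] := bounded_geometry_fset bg r0.
exists N => F y c c0; have [G GN GP] := NP y.
apply: (@le_trans _ _ (\sum_(z <- G) c)).
  rewrite -big_filter; have -> : \sum_(z <- [seq z <- F | mdist y z <= r]) c =
     \sum_(z <- [fset z in F | mdist y z <= r]%fset) c.
    apply: perm_big; apply: uniq_perm; rewrite ?filter_uniq ?fset_uniq//.
    by move=> z; rewrite mem_filter !inE/= andbC.
  apply: ler_sum_fsubset => //; apply/fsubsetP => z.
  by rewrite !inE/= GP => /andP[].
by rewrite big_const_seq count_predT iter_addr_0 -[c *+ _]mulr_natl ler_wpM2r// ler_nat.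
Qed.

(** Take for [phi i y] the value at [i] of the indicator of [A y], normalized in l2. The sum over
    [i] of the products is then the size of the intersection divided by the geometric mean of the
    sizes. For points of a finite [F] only indices in the finite union [J] of their sets matter. *)
Lemma property_A_partition (r e : R) : property_A Y -> 0 < r -> 0 < e ->
  exists (phi : Y * nat -> Y -> R) (s : R),
  [/\ 0 < s, forall i y, 0 <= phi i y,
      forall i y y', 0 < phi i y * phi i y' -> mdist y y' <= s &
      forall F : {fset Y}, exists J : {fset Y * nat},
        (forall y, y \in F -> \sum_(i <- J) phi i y ^+ 2 = 1) /\
        (forall y y', y \in F -> y' \in F -> mdist y y' <= r ->
          1 - e <= \sum_(i <- J) phi i y * phi i y')].
Proof.
move=> PA r0 e0; have [A [A1 Ar [s s0 As]]] := PA _ _ r0 e0.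
pose phi (i : Y * nat) y : R := (i \in A y)%:R / Num.sqrt (#|` A y|%fset)%:R.
have phi0 i y : 0 <= phi i y by rewrite divr_ge0// sqrtr_ge0.
have An y : 0 < (#|` A y|%fset)%:R :> R.
  by rewrite ltr0n cardfs_gt0; apply/fset0Pn; exists (y, 1%N).
(* Since [(y, 1)] lies in [A y], each of the two points is within [s] of the first component of
   [i]. *)
exists phi, (s + s); split => //; first by rewrite addr_gt0.
  move=> i y y'; have [iy|iy] := boolP (i \in A y); last first.
    by rewrite /phi (negPf iy) mul0r mul0r ltxx.
  have [iy'|iy'] := boolP (i \in A y'); last first.
    by rewrite /phi (negPf iy') mul0r mulr0 ltxx.
  move=> _; case: i iy iy' => z n iy iy'.
  apply: le_trans (metric_triangle _ z _) _; apply: lerD.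
    exact: As (A1 y) iy.
  by rewrite metric_sym; exact: As (A1 y') iy'.
move=> F; exists (\bigcup_(y <- F) A y)%fset.
set J := (\bigcup_(y <- F) A y)%fset.
have AJ y : y \in F -> (A y `<=` J)%fset by move=> yF; exact: bigfcup_sup.
have sumE y y' : y \in F -> \sum_(i <- J) phi i y * phi i y' =
    (#|` A y `&` A y'|%fset)%:R / (Num.sqrt (#|` A y|%fset)%:R * Num.sqrt (#|` A y'|%fset)%:R).
  move=> yF; rewrite -(@big_fset_incl _ _ _ _ (A y `&` A y')%fset).
  - rewrite big_seq (eq_bigr (fun=> 1 / (Num.sqrt (#|` A y|%fset)%:R * Num.sqrt (#|` A y'|%fset)%:R))).
      rewrite -big_seq -mulr_suml; congr (_ / _).
      by rewrite big_const_seq count_predT iter_addr_0.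
    by move=> i; rewrite /phi inE => /andP[-> ->]; rewrite mulf_div mulr1.
  - apply: fsubset_trans (AJ _ yF); exact: fsubsetIl.
  - move=> i _; rewrite inE negb_and /phi => /orP[] /negPf ->.
      by rewrite !mul0r.
    by rewrite mul0r mulr0.
split=> [y yF|y y' yF y'F yy'].
  under eq_bigr do rewrite expr2.
  by rewrite sumE// fsetIid -expr2 sqr_sqrtr ?divff ?gt_eqF// ltW.
rewrite sumE//; have [I0 Ie] := Ar _ _ yy'.
have n0 : 0 < (#|` A y `&` A y'|%fset)%:R :> R by rewrite ltr0n cardfs_gt0.
move: Ie; rewrite ltr_pdivrMr//.
rewrite cardfsU (_ : (_ `&` _)%fset = fset0); last first.
  apply/fsetP => i; rewrite !inE; case: (i \in A y); case: (i \in A y') => //.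
rewrite cardfs0 subn0 natrD.
have h1 := cardfsID (A y') (A y); have h2 := cardfsID (A y) (A y').
have : (#|` A y|%fset)%:R = (#|` A y `&` A y'|%fset)%:R + (#|` A y `\` A y'|%fset)%:R :> R.
  by rewrite -natrD h1.
have : (#|` A y'|%fset)%:R = (#|` A y `&` A y'|%fset)%:R + (#|` A y' `\` A y|%fset)%:R :> R.
  by rewrite -natrD fsetIC h2.
move: (An y) (An y') n0.
set n := (#|` A y `&` A y'|%fset)%:R; set a := (#|` A y|)%:R; set b := (#|` A y'|)%:R.
set p := (#|` A y `\` A y'|%fset)%:R; set q := (#|` A y' `\` A y|%fset)%:R => a0 b0 n0 bE aE pq.
have sa : Num.sqrt a ^+ 2 = a by rewrite sqr_sqrtr// ltW.
have sb : Num.sqrt b ^+ 2 = b by rewrite sqr_sqrtr// ltW.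
have sa0 : 0 < Num.sqrt a by rewrite sqrtr_gt0.
have sb0 : 0 < Num.sqrt b by rewrite sqrtr_gt0.
have p0 : 0 <= p by exact: ler0n.
have q0 : 0 <= q by exact: ler0n.
rewrite ler_pdivlMr ?mulr_gt0//.
(* The geometric mean is at most the arithmetic mean, that is [n + (p + q) / 2], and [p + q] is
   below [e * n]. The claim then follows from [(1 - e) * (1 + e) <= 1]; for [e] above [1] its left
   side is negative. *)
have hab : Num.sqrt a * Num.sqrt b <= n * (1 + e).
  have := sqr_ge0 (Num.sqrt a - Num.sqrt b); rewrite sqrrB sa sb.
  by lra.
have [e1|e1] := leP e 1; last first.
  apply: (@le_trans _ _ 0); last exact: ltW.
  by rewrite nmulr_rle0 ?ltW ?mulr_gt0//; lra.
apply: (@le_trans _ _ ((1 - e) * (n * (1 + e)))).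
  by rewrite ler_wpM2l//; lra.
have := sqr_ge0 e; nra.
Qed.

End bounded_geometry_property_A.

(** * Schur multipliers and their quadratic forms *)

Section schur_forms.
Context {R : realType} (X Y : choiceType) (H : hilbertType R).
Implicit Types (f g : l2 Y H) (F : {fset Y}).

Definition rdot (Z : choiceType) (f g : l2 Z H) : R := complex.Re (l2dot f g).

Lemma rdot_le (Z : choiceType) (f g : l2 Z H) (t : R) : 0 < t ->
  l2sq f <= t ^+ 2 -> l2sq g <= 1 -> rdot f g <= t.
Proof.
move=> t0 ft g1; have := young (@l2dot R Z H) f g t0; rewrite !l2dot_sq => h.
apply: le_trans h _.
have : l2sq f / t <= t by rewrite ler_pdivrMr// -expr2.
have := l2sq_ge0 g; nra.
Qed.

(** The real part of <(w . D) f, g> truncated to [F], where w . D is the Schur product of the matrix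
    of [D] with the weights [w]; working with the form avoids constructing w . D as an operator. *)
Definition schur_form (F : {fset Y}) (w : Y -> Y -> R) (f g : l2 Y H)
    (D : l2 Y H -> l2 Y H) : R :=
  \sum_(y <- F) \sum_(y' <- F)
    w y y' * rdot (D (single y (f y))) (single y' (g y')).

Lemma schur_formB F w f g D E :
  schur_form F w f g (fun h => D h - E h) = schur_form F w f g D - schur_form F w f g E.
Proof.
rewrite /schur_form -sumrB; apply: eq_bigr => y _; rewrite -sumrB.
by apply: eq_bigr => y' _; rewrite /rdot dotBl raddfB mulrBr.
Qed.

Lemma schur_form_weightB F w w' f g D :
  schur_form F (fun y y' => w y y' - w' y y') f g D =
  schur_form F w f g D - schur_form F w' f g D.
Proof.
rewrite /schur_form -sumrB; apply: eq_bigr => y _; rewrite -sumrB.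
by apply: eq_bigr => y' _; rewrite mulrBl.
Qed.

Lemma rdot_fsupp F (D : l2 Y H -> l2 Y H) (a b : Y -> H) : linear D ->
  rdot (D (fsupp F a)) (fsupp F b) =
  \sum_(y <- F) \sum_(y' <- F) rdot (D (single y (a y))) (single y' (b y')).
Proof.
move=> linD; rewrite /fsupp (lin_sum linD) /rdot dot_suml raddf_sum.
apply: eq_bigr => y _; rewrite /= l2dotC dot_suml raddf_sum/= raddf_sum/=.
by apply: eq_bigr => y' _; rewrite -l2dotC.
Qed.

Lemma schur_form1 F f g D : linear D ->
  schur_form F (fun _ _ => 1) f g D = rdot (D (fsupp F f)) (fsupp F g).
Proof.
move=> linD; rewrite rdot_fsupp//; apply: eq_bigr => y _.
by apply: eq_bigr => y' _; rewrite mul1r.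
Qed.

Definition localize (I : choiceType) (phi : I -> Y -> R) F i f : l2 Y H :=
  fsupp F (fun y => (phi i y)%:C *: f y).

Section partition.
Variables (I : choiceType) (phi : I -> Y -> R) (F : {fset Y}) (J : {fset I}).
Hypothesis phi_ge0 : forall i y, 0 <= phi i y.
Hypothesis phi_sum : forall y, y \in F -> \sum_(i <- J) phi i y ^+ 2 = 1.

Let k y y' := \sum_(i <- J) phi i y * phi i y'.

(** The weight [k] belongs to the multiplier that sends D to the sum of the blocks phi_i D phi_i. *)
Lemma schur_form_partition f g D : linear D ->
  schur_form F k f g D =
  \sum_(i <- J) rdot (D (localize phi F i f)) (localize phi F i g).
Proof.
move=> linD; under [RHS]eq_bigr do rewrite rdot_fsupp//.
rewrite exchange_big/=; apply: eq_bigr => y _.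
rewrite exchange_big/=; apply: eq_bigr => y' _.
rewrite mulr_suml; apply: eq_bigr => i _.
rewrite !(linZ (single_linear (H := H) _)) (linZ linD) /rdot dotZl dotZr.
by rewrite conjc_real !Re_scale mulrA.
Qed.

Lemma sum_localize f : \sum_(i <- J) l2sq (localize phi F i f) = \sum_(y <- F) sqnorm (f y).
Proof.
under eq_bigr do rewrite l2sq_fsupp.
rewrite exchange_big/= big_seq [RHS]big_seq; apply: eq_bigr => y yF.
rewrite -[RHS]mul1r -(phi_sum yF) mulr_suml; apply: eq_bigr => i _.
by rewrite -hdotE dotsqZ cmodR// hdotE.
Qed.

(** Young's inequality on each block, with weight [t]. Only the values of [D] on the localized
    pieces of [f] have to be small, so this serves operators of small norm and also the cross
    terms. *)
Lemma schur_form_le f g D (t : R) : linear D -> 0 < t ->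
  \sum_(i <- J) l2sq (D (localize phi F i f)) <= t ^+ 2 -> l2sq g <= 1 ->
  schur_form F k f g D <= t.
Proof.
move=> linD t0 ft g1; rewrite schur_form_partition//.
apply: (@le_trans _ _ (\sum_(i <- J)
   ((l2sq (D (localize phi F i f)) / t + t * l2sq (localize phi F i g)) / 2))).
  by apply: ler_sum => i _; rewrite -!l2dot_sq; exact: young.
rewrite -mulr_suml big_split/= -mulr_suml -mulr_sumr (sum_localize g).
have : (\sum_(i <- J) l2sq (D (localize phi F i f))) / t <= t.
  by rewrite ler_pdivrMr// -expr2.
have := sum_le_l2sq g F; nra.
Qed.

Lemma kernel_le1 y y' : y \in F -> y' \in F -> k y y' <= 1.
Proof.
move=> yF y'F; apply: (@le_trans _ _ (\sum_(i <- J) ((phi i y ^+ 2 + phi i y' ^+ 2) / 2))).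
  by apply: ler_sum => i _; have := sqr_ge0 (phi i y - phi i y'); rewrite sqrrB; lra.
by rewrite -mulr_suml big_split/= !phi_sum//; lra.
Qed.

(* Expand into a double sum with weights [k <= 1]. *)
Lemma sum_sqr_partition (c : Y -> R) : (forall y, 0 <= c y) ->
  \sum_(i <- J) (\sum_(y <- F) phi i y * c y) ^+ 2 <= (\sum_(y <- F) c y) ^+ 2.
Proof.
move=> c0; under eq_bigr do rewrite expr2 big_distrlr/=.
rewrite expr2 big_distrlr/= exchange_big/= big_seq [leRHS]big_seq.
apply: ler_sum => y yF; rewrite exchange_big/= big_seq [leRHS]big_seq.
apply: ler_sum => y' y'F.
rewrite (eq_bigr (fun i => phi i y * phi i y' * (c y * c y'))); last first.
  by move=> i _; rewrite mulrACA.
by rewrite -mulr_suml ler_piMl ?mulr_ge0// kernel_le1.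
Qed.

End partition.

End schur_forms.

Section band_form.
Context {R : realType} (Y : metricType R) (H : hilbertType R).

Lemma rdot_matrix_le (D : l2 Y H -> l2 Y H) (M : R) y y' (u w : H) : 0 <= M ->
  (forall f, l2norm (D f) <= M * l2norm f) ->
  rdot (D (single y u)) (single y' w) <= M * ((sqnorm u + sqnorm w) / 2).
Proof.
move=> M0 DM; apply: le_trans (le_Re_cmod _) _; apply: le_trans (l2norm_cauchy _ _) _.
have := DM (single y u); have := l2norm_sq (single y u : l2 Y H).
have := l2norm_sq (single y' w : l2 Y H); rewrite !l2sq_single => <- <-.
have := l2norm_ge0 (single y' w : l2 Y H).
set a := l2norm (D _); set b := l2norm (single y' w); set c := l2norm _ => b0 ac.
apply: (@le_trans _ _ (M * c * b)); first by rewrite ler_wpM2r.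
rewrite -mulrA ler_wpM2l//; have := sqr_ge0 (c - b); rewrite sqrrB; lra.
Qed.

(** A Schur test: a pair in the band contributes at most [e * M] times the mean of the two masses,
    and each point lies in at most [N] such pairs on either side. *)
Lemma schur_form_band (D : l2 Y H -> l2 Y H) (F : {fset Y}) (w : Y -> Y -> R)
    (f g : l2 Y H) (M s e : R) (N : nat) :
  0 <= M -> 0 <= e -> (forall h, l2norm (D h) <= M * l2norm h) ->
  (forall x y, s <= mdist x y -> matrix_coef D x y = (fun=> 0)) ->
  (forall (y : Y) (c : R), 0 <= c -> \sum_(z <- F | mdist y z <= s) c <= N%:R * c) ->
  (forall y y', y \in F -> y' \in F -> mdist y y' <= s -> 0 <= w y y' <= e) ->
  l2sq f <= 1 -> l2sq g <= 1 -> schur_form F w f g D <= e * M * N%:R.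
Proof.
move=> M0 e0 DM Ds FN we f1 g1.
pose c y y' := e * M * ((sqnorm (f y) + sqnorm (g y')) / 2).
apply: (@le_trans _ _ (\sum_(y <- F) \sum_(y' <- F | mdist y y' <= s) c y y')).
  rewrite /schur_form big_seq [leRHS]big_seq; apply: ler_sum => y yF.
  rewrite [leRHS]big_mkcond/= big_seq [leRHS]big_seq; apply: ler_sum => y' y'F.
  case: ifPn => [yy'|]; last first.
    rewrite -ltNge => /ltW yy'.
    rewrite /rdot l2dotC l2dot_single -[D _ y']/(matrix_coef D y' y _) Ds; last first.
      by rewrite metric_sym.
    by rewrite dot0r conjc0 mulr0.
  have /andP[w0 w1] := we _ _ yF y'F yy'.
  apply: (@le_trans _ _ (w y y' * (M * ((sqnorm (f y) + sqnorm (g y')) / 2)))).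
    by rewrite ler_wpM2l// rdot_matrix_le.
  rewrite /c -mulrA ler_wpM2r//; apply: mulr_ge0 => //.
  by rewrite divr_ge0 ?addr_ge0 ?sqnorm_ge0.
have eM : 0 <= e * M by rewrite mulr_ge0.
have cE y y' : c y y' = e * M / 2 * sqnorm (f y) + e * M / 2 * sqnorm (g y').
  by rewrite /c; lra.
rewrite (eq_bigr (fun y => \sum_(y' <- F | mdist y y' <= s) e * M / 2 * sqnorm (f y) +
  \sum_(y' <- F | mdist y y' <= s) e * M / 2 * sqnorm (g y'))); last first.
  by move=> y _; rewrite -big_split/=; apply: eq_bigr => y' _; exact: cE.
rewrite big_split/=.
have h1 : \sum_(y <- F) \sum_(y' <- F | mdist y y' <= s) e * M / 2 * sqnorm (f y)
    <= N%:R * (e * M / 2).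
  apply: (@le_trans _ _ (\sum_(y <- F) N%:R * (e * M / 2 * sqnorm (f y)))).
    by apply: ler_sum => y _; apply: FN; apply: mulr_ge0 (sqnorm_ge0 _); rewrite divr_ge0.
  rewrite -mulr_sumr ler_wpM2l// -mulr_sumr ler_piMr//; first by rewrite divr_ge0.
  exact: le_trans (sum_le_l2sq _ _) f1.
have h2 : \sum_(y <- F) \sum_(y' <- F | mdist y y' <= s) e * M / 2 * sqnorm (g y')
    <= N%:R * (e * M / 2).
  rewrite (exchange_big_dep predT)//=.
  apply: (@le_trans _ _ (\sum_(y <- F) N%:R * (e * M / 2 * sqnorm (g y)))).
    apply: ler_sum => y _; under eq_bigl do rewrite metric_sym.
    by apply: FN; apply: mulr_ge0 (sqnorm_ge0 _); rewrite divr_ge0.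
  rewrite -mulr_sumr ler_wpM2l// -mulr_sumr ler_piMr//; first by rewrite divr_ge0.
  exact: le_trans (sum_le_l2sq _ _) g1.
apply: le_trans (lerD h1 h2) _; lra.
Qed.

End band_form.

(** * Concentration of images of nearby points *)

Section escaping_sequences.
Context {R : realType}.

Definition escapes (X : choiceType) (x : nat -> X) :=
  forall y, \forall n \near \oo, x n != y.

Lemma near_fset (X : choiceType) (F : {fset X}) (P : X -> nat -> Prop) :
  (forall y, y \in F -> \forall n \near \oo, P y n) ->
  \forall n \near \oo, forall y, y \in F -> P y n.
Proof.
elim/fset1U_rect: F => [_|y F yF IH h]; first by near=> n => y; rewrite inE.
have hy := h y (fset1U1 _ _).
have hF : \forall n \near \oo, forall y, y \in F -> P y n.
  by apply: IH => z zF; apply: h; rewrite !inE zF orbT.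
near=> n => z; rewrite !inE => /orP[/eqP ->|zF]; first by near: n.
by move: z zF; near: n.
Unshelve. all: by end_near. Qed.

Lemma escapes_fset (X : choiceType) (x : nat -> X) (F : {fset X}) : escapes x ->
  \forall n \near \oo, x n \notin F.
Proof.
move=> ex; have : \forall n \near \oo, forall y, y \in F -> x n != y.
  by apply: near_fset => y _; exact: ex.
by apply: filterS => n h; apply/negP => /h; rewrite eqxx.
Qed.

(** The list of the first [k] chosen indices. The next one adds up the thresholds imposed by all
    earlier ones, and so exceeds each of them. *)
Fixpoint greedy (N : nat -> nat -> nat) (k : nat) : seq nat :=
  if k is k'.+1 then rcons (greedy N k') (k' + \sum_(m <- greedy N k') N k' m)
  else [::].

Lemma subsequence (Q : nat -> nat -> nat -> Prop) :
  (forall k m, \forall n \near \oo, Q k m n) ->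
  exists e : nat -> nat, (forall k, (k <= e k)%N) /\
    forall j k, (j < k)%N -> Q k (e j) (e k).
Proof.
move=> QN.
have /choice[N NP] : forall km : nat * nat, exists N, forall n, (N <= n)%N -> Q km.1 km.2 n.
  by move=> [k m]; have [N _ NQ] := QN k m; exists N.
pose M k m := N (k, m).
pose e k := (k + \sum_(m <- greedy M k) M k m)%N.
have mem_greedy k j : (j < k)%N -> e j \in greedy M k.
  elim: k => // k IH; rewrite ltnS leq_eqVlt /= mem_rcons inE => /orP[/eqP ->|/IH ->].
    by rewrite eqxx.
  by rewrite orbT.
exists e; split=> [k|j k jk]; first exact: leq_addr.
apply: (NP (k, e j)); rewrite /e.
by rewrite (big_rem _ (mem_greedy _ _ jk))/= addnCA leq_addr.
Qed.

End escaping_sequences.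

Section weak_convergence.
Context {R : realType} (X Y : metricType R) (H : hilbertType R).

Lemma single_weakly_null (g : l2 X H) (x : nat -> X) (v : nat -> H) (e : R) :
  escapes x -> (forall n, sqnorm (v n) <= 1) -> 0 < e ->
  \forall n \near \oo, cmod (l2dot g (single (x n) (v n))) <= e.
Proof.
move=> ex v1 e0; have [F FP] := fsupp_approx g (exprn_gt0 2 e0).
have := escapes_fset F ex; apply: filterS => n xF.
rewrite l2dotC l2dot_single cmod_conj.
rewrite -ler_sqr ?nnegrE ?cmod_ge0 ?(ltW e0)//.
apply: le_trans (cauchy_schwarz _ _ _) _; rewrite !hdotE.
have := sqnorm_le_l2sq (g - fsupp F g) (x n).
rewrite l2D l2N fsuppE (negPf xF) subr0.
have := FP F (fsubset_refl _); have := v1 n; have := sqnorm_ge0 (v n).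
have := sqnorm_ge0 (g (x n)); nra.
Qed.

Variables (U : l2 X H -> l2 Y H) (V : l2 Y H -> l2 X H).
Hypothesis UV : roe_unitary U V.

Lemma l2dot_adj f g : l2dot f (U g) = l2dot (V f) g.
Proof. by have [_ _ UK iso _] := UV; rewrite -[in LHS](UK f) iso. Qed.

Lemma unitary_linear_inv : linear V.
Proof.
have [lin VK UK _ _] := UV.
by move=> a u v; apply: (can_inj VK); rewrite lin !UK.
Qed.

Lemma unitary_l2sq f : l2sq (U f) = l2sq f.
Proof. by have [_ _ _ iso _] := UV; rewrite -!l2dot_sq /dotsq/= iso. Qed.

Lemma unitary_inv_l2sq f : l2sq (V f) = l2sq f.
Proof. by have [_ _ UK _ _] := UV; rewrite -unitary_l2sq UK. Qed.

Lemma unitary_weakly_null (g : l2 Y H) (x : nat -> X) (v : nat -> H) (e : R) :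
  escapes x -> (forall n, sqnorm (v n) <= 1) -> 0 < e ->
  \forall n \near \oo, cmod (l2dot g (U (single (x n) (v n)))) <= e.
Proof.
move=> ex v1 e0; have := single_weakly_null (V g) ex v1 e0.
by apply: filterS => n; rewrite l2dot_adj.
Qed.

(** Absolute values are summed, so weak convergence alone is not enough: it handles the finite set
    [G] carrying almost all of [g], and Young's inequality handles the small remainder of [g]. *)
Lemma overlap_null (g : l2 Y H) (x : nat -> X) (v : nat -> H) (e : R) :
  escapes x -> (forall n, sqnorm (v n) <= 1) -> 0 < e ->
  \forall n \near \oo, forall F : {fset Y},
    \sum_(y <- F) cmod (hdot (g y) (U (single (x n) (v n)) y)) <= e.
Proof.
move=> ex v1 e0; pose t := e / 2; have t0 : 0 < t by rewrite divr_gt0.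
have [G /(_ G (fsubset_refl _)) Gg] := fsupp_approx g (exprn_gt0 2 t0).
(* With this bound at each point of [G], their total is at most [t]; the added [1] covers an empty
   [G]. *)
pose d : R := t / (#|` G|%:R + 1).
have d0 : 0 < d by rewrite divr_gt0// ltr_wpDl.
have : \forall n \near \oo, forall y, y \in G ->
    cmod (l2dot (single y (g y)) (U (single (x n) (v n)))) <= d.
  by apply: near_fset => y _; exact: unitary_weakly_null.
apply: filterS => n nG F; set xi := U _ in nG *.
pose c y := cmod (hdot (g y) (xi y)).
apply: (@le_trans _ _ (\sum_(y <- (F `|` G)%fset) c y)).
  by apply: ler_sum_fsubset (fsubsetUl _ _) => y; exact: cmod_ge0.
rewrite (big_fsetID _ [in G] (F `|` G)%fset)/=.
rewrite (_ : [fset y in (F `|` G)%fset | y \in G]%fset = G); last first.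
  by apply/fsetP => y; rewrite !inE/=; case: (y \in G); rewrite ?orbT ?andbF.
have -> : e = t + t by rewrite /t; lra.
apply: lerD.
  apply: (@le_trans _ _ (\sum_(y <- G) d)).
    rewrite big_seq [leRHS]big_seq; apply: ler_sum => y yG.
    by rewrite /c -l2dot_single nG.
  rewrite big_const_seq count_predT iter_addr_0 -mulr_natr /d mulrAC ler_pdivrMr ?ltr_wpDl//.
  by rewrite ler_wpM2l ?(ltW t0)// lerDl.
set K := [fset y in _ | _]%fset.
pose g' := g - fsupp G g.
apply: (@le_trans _ _ (\sum_(y <- K) ((sqnorm (g' y) / t + t * sqnorm (xi y)) / 2))).
  rewrite big_seq [leRHS]big_seq; apply: ler_sum => y.
  rewrite /K !inE/= => /andP[_ yG].
  have -> : c y = cmod (hdot (g' y) (xi y)).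
    by rewrite /g' l2D l2N fsuppE (negPf yG) subr0.
  have := cauchy_schwarz hdot (g' y) (xi y); rewrite !hdotE.
  have := cmod_ge0 (hdot (g' y) (xi y)).
  set p := cmod _; set a := sqnorm (g' y); set b := sqnorm (xi y) => p0 pab.
  have a0 : 0 <= a by exact: sqnorm_ge0.
  have b0 : 0 <= b by exact: sqnorm_ge0.
  have tp : 2 * t * p <= a + t ^+ 2 * b.
    have t2p : 0 <= 2 * t * p by rewrite !mulr_ge0// ltW.
    have t2b : 0 <= a + t ^+ 2 * b by rewrite addr_ge0// mulr_ge0// sqr_ge0.
    rewrite -ler_sqr ?nnegrE//.
    by have := sqr_ge0 (a - t ^+ 2 * b); have := sqr_ge0 t; nra.
  have tt : t * t^-1 = 1 by rewrite divff// gt_eqF.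
  have t2 : 0 < 2 * t by rewrite mulr_gt0.
  rewrite -(ler_pM2l t2); apply: le_trans tp _.
  rewrite (_ : 2 * t * _ = a * (t * t^-1) + t ^+ 2 * b); last by lra.
  by rewrite tt mulr1.
rewrite -mulr_suml big_split/= -mulr_suml -mulr_sumr.
have k1 : \sum_(y <- K) sqnorm (g' y) <= t ^+ 2.
  exact: le_trans (sum_le_l2sq _ _) (ltW Gg).
have k2 : \sum_(y <- K) sqnorm (xi y) <= 1.
  by apply: le_trans (sum_le_l2sq _ _) _; rewrite unitary_l2sq l2sq_single.
have : (\sum_(y <- K) sqnorm (g' y)) / t <= t by rewrite ler_pdivrMr// -expr2.
nra.
Qed.

End weak_convergence.

Section finite_sums_of_l2sq.
Context {R : realType} (X : choiceType) (H : hilbertType R) (I : Type).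

(** A single finite set [Z] approximates all of the finitely many norms at once. *)
Lemma sum_l2sq_le (J : seq I) (f : I -> l2 X H) (M : R) :
  (forall Z : {fset X}, \sum_(i <- J) \sum_(z <- Z) sqnorm (f i z) <= M) ->
  \sum_(i <- J) l2sq (f i) <= M.
Proof.
move=> fM; apply/ler_addgt0Pr => e e0.
suff [Z fZ] : exists Z : {fset X}, \sum_(i <- J) l2sq (f i) <=
    \sum_(i <- J) \sum_(z <- Z) sqnorm (f i z) + e.
  by apply: le_trans fZ _; rewrite lerD2r.
elim: J e e0 {fM} => [|i J IH] e e0.
  by exists fset0; rewrite !big_nil add0r ltW.
have e20 : 0 < e / 2 by rewrite divr_gt0.
have [Z1 h1] := IH _ e20; have [Z2 h2] := l2sq_approx (f i) e20.
exists (Z1 `|` Z2)%fset; rewrite !big_cons.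
have h3 : \sum_(j <- J) \sum_(z <- Z1) sqnorm (f j z) <=
    \sum_(j <- J) \sum_(z <- (Z1 `|` Z2)%fset) sqnorm (f j z).
  by apply: ler_sum => j _; apply: ler_sum_fsubset (fsubsetUl _ _) => z; exact: sqnorm_ge0.
have h4 : \sum_(z <- Z2) sqnorm (f i z) <= \sum_(z <- (Z1 `|` Z2)%fset) sqnorm (f i z).
  by apply: ler_sum_fsubset (fsubsetUr _ _) => z; exact: sqnorm_ge0.
lra.
Qed.

Lemma sum_half_pow (K : {fset nat}) : \sum_(k <- K) (2^-1 : R) ^+ k.+1 <= 1.
Proof.
have [N KN] : exists N, forall k, k \in K -> (k < N)%N.
  exists (\sum_(k <- K) k).+1 => k kK.
  by rewrite ltnS (big_rem k)//= leq_addr.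
apply: (@le_trans _ _ (\sum_(k <- [fset k in iota 0 N]%fset) (2^-1 : R) ^+ k.+1)).
  apply: ler_sum_fsubset => [k|]; first by rewrite exprn_ge0.
  by apply/fsubsetP => k kK; rewrite !inE mem_iota leq0n add0n KN.
rewrite (_ : \sum_(k <- _) _ = \sum_(k <- iota 0 N) (2^-1 : R) ^+ k.+1); last first.
  by apply: perm_big; apply: uniq_perm; rewrite ?fset_uniq ?iota_uniq// => k; rewrite !inE.
suff -> : \sum_(k <- iota 0 N) (2^-1 : R) ^+ k.+1 = 1 - 2^-1 ^+ N.
  by rewrite gerBl exprn_ge0.
elim: N {KN} => [|N IH]; first by rewrite big_nil expr0 subrr.
by rewrite -addn1 iotaD big_cat IH/= big_seq1 add0n !addn1 exprS; lra.
Qed.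

End finite_sums_of_l2sq.

(** * The key estimate for a sequence of almost disjoint images *)

Section key_estimate.
Context {R : realType} (X Y : metricType R) (H : hilbertType R).

(* For unit vectors, [sqnorm (f y) * sqnorm (g y')] are the weights of a product
   probability on pairs. *)
Definition near_mass (Z : metricType R) (f g : l2 Z H) (r t : R) :=
  exists F : {fset Z}, t <= \sum_(y <- F) \sum_(y' <- F | mdist y y' <= r)
    sqnorm (f y) * sqnorm (g y').

Variables (U : l2 X H -> l2 Y H) (V : l2 Y H -> l2 X H).
Hypothesis UV : roe_unitary U V.
Hypotheses (Y_bounded : bounded_geometry Y) (Y_A : property_A Y).
Variables (x x' : nat -> X) (v v' : nat -> H) (r e : R).
Hypotheses (x_inj : injective x) (x'_inj : injective x').
Hypothesis xx'r : forall n, mdist (x' n) (x n) <= r.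
Hypotheses (v1 : forall n, sqnorm (v n) = 1) (v'1 : forall n, sqnorm (v' n) = 1).
Hypothesis e0 : 0 < e.

Let xi n := U (single (x n) (v n)).
Let xi' n := U (single (x' n) (v' n)).

Hypothesis overlap : forall n k (F : {fset Y}), k != n ->
  \sum_(y <- F) cmod (hdot (xi n y) (xi k y)) <= e * 2^-1 ^+ k.+1.

Let idx (z : X) : option nat :=
  if pselect (exists n, x' n == z) is left h then Some (xchoose h) else None.

Let idxP z n : idx z = Some n <-> x' n = z.
Proof.
rewrite /idx; case: pselect => [h|h]; split => //.
- by move=> [<-]; apply/eqP; exact: (xchooseP h).
- by move=> xn; congr Some; apply: x'_inj; rewrite xn; apply/eqP; exact: (xchooseP h).
- by move=> xn; exfalso; apply: h; exists n; rewrite xn.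
Qed.

(** Dropping the index [n] leaves the partial translation without its [n]th term, so [Tn n] kills
    the source vector of that term. *)
Let idxn n z := if x' n == z then None else idx z.

Let T := transl idx x v v'.
Let Tn n := transl (idxn n) x v v'.

Let T_data : transl_data idx x v v'.
Proof.
split => [z z' j /idxP <- /idxP <- //||j|j].
- exact: x_inj.
- by rewrite v1.
- by rewrite v'1.
Qed.

Let Tn_data n : transl_data (idxn n) x v v'.
Proof.
split => [z z' j||j|j].
- by rewrite /idxn; case: ifP => // _ /idxP <-; case: ifP => // _ /idxP <-.
- exact: x_inj.
- by rewrite v1.
- by rewrite v'1.
Qed.

Let T_split n f : T f = Tn n f + single (x' n) (hdot (f (x n)) (v n) *: v' n).
Proof.
apply: l2_ext => z; rewrite l2D (translE T_data) (translE (Tn_data n)) singleE.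
rewrite /transl_fun /idxn (eq_sym z); case: eqP => [xz|_]; last by rewrite addr0.
by rewrite (idxP z n).2// add0r.
Qed.

Let Tn_single n : Tn n (single (x n) (v n)) = 0.
Proof.
apply: l2_ext => z; rewrite (translE (Tn_data n)) /transl_fun /idxn.
case: eqP => // xz; case jz: (idx z) => [j|]//=.
case: eqP => [/x_inj jn|_]; last by rewrite dot0l scale0r.
by move/idxP: jz; rewrite jn.
Qed.

Let T_roe : roe X H T.
Proof.
apply: algebraic_roe_roe; apply: (@transl_roe _ _ _ _ _ _ _ _ T_data r).
by move=> z j /idxP <-.
Qed.

Let U_lin : linear U. Proof. by case: UV. Qed.
Let V_lin : linear V. Proof. exact: unitary_linear_inv UV. Qed.

Let T_lin : linear T. Proof. exact: transl_linear T_data. Qed.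
Let Tn_lin n : linear (Tn n). Proof. exact: transl_linear (Tn_data n). Qed.

Let S := U \o T \o V.

Let S_lin : linear S.
Proof. by move=> a f g; rewrite /S/= V_lin T_lin U_lin. Qed.

Let S_l2sq f : l2sq (S f) <= l2sq f.
Proof.
rewrite /S/= (unitary_l2sq UV) -[leRHS](unitary_inv_l2sq UV).
exact: (l2sq_transl T_data (V f)).
Qed.

Let UTnV_lin n : linear (U \o Tn n \o V).
Proof. by move=> a f g; rewrite /= V_lin Tn_lin U_lin. Qed.

Let xi_sq n : l2sq (xi n) = 1.
Proof. by rewrite (unitary_l2sq UV) l2sq_single. Qed.

Let xi'_sq n : l2sq (xi' n) = 1.
Proof. by rewrite (unitary_l2sq UV) l2sq_single. Qed.

Let S_xi n : S (xi n) = xi' n.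
Proof.
have [_ VK _ _ _] := UV.
rewrite /S /xi/= VK (T_split n) Tn_single add0r singleE eqxx dotE hdotE v1.
by rewrite scale1r.
Qed.

Section partition.
Variables (phi : Y * nat -> Y -> R) (F : {fset Y}) (J : {fset Y * nat}).
Hypothesis phi_ge0 : forall i y, 0 <= phi i y.
Hypothesis phi_sum : forall y, y \in F -> \sum_(i <- J) phi i y ^+ 2 = 1.

Let k y y' := \sum_(i <- J) phi i y * phi i y'.

(** The squared norm of a piece is at most the sum over [j] of its squared overlaps with [xi j]. By
    [sum_sqr_partition] the sum over the pieces is controlled by the overlaps of [xi n] itself,
    which decay geometrically in [j]. *)
Lemma cross_terms n :
  \sum_(i <- J) l2sq ((U \o Tn n \o V) (localize phi F i (xi n))) <= e ^+ 2.
Proof.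
under eq_bigr do rewrite /= (unitary_l2sq UV).
apply: sum_l2sq_le => Z.
have [K KZ fK] := sum_transl_fun (Tn_data n) Z.
apply: (@le_trans _ _ (\sum_(i <- J) \sum_(j <- K)
    (\sum_(y <- F) phi i y * cmod (hdot (xi n y) (xi j y))) ^+ 2)).
  apply: ler_sum => i _; rewrite (translE (Tn_data n)).
  apply: le_trans (fK _) _; apply: ler_sum => j _.
  rewrite ler_sqr ?nnegrE ?cmod_ge0//; last first.
    by rewrite sumr_ge0// => y _; rewrite mulr_ge0// cmod_ge0.
  rewrite -l2dot_singler -(l2dot_adj UV) l2dot_fsupp.
  apply: le_trans (cmod_sum _ _ _) _; apply: ler_sum => y _.
  by rewrite dotZl cmodM cmodR.
rewrite exchange_big/=.
apply: (@le_trans _ _ (\sum_(j <- K) e ^+ 2 * 2^-1 ^+ j.+1)); last first.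
  by rewrite -mulr_sumr ler_piMr ?sqr_ge0// sum_half_pow.
rewrite big_seq [leRHS]big_seq; apply: ler_sum => j jK.
(* The overlap of [xi n] with itself never occurs, since [idxn n] does not take the value [n]. *)
have jn : j != n.
  have [z _] := KZ _ jK; rewrite /idxn; case: eqP => // xz /idxP xj.
  by apply/eqP => jn; apply: xz; rewrite -jn.
have c0 y : 0 <= cmod (hdot (xi n y) (xi j y)) by exact: cmod_ge0.
apply: le_trans (sum_sqr_partition phi_sum c0) _.
have := overlap F jn; have : 0 <= \sum_(y <- F) cmod (hdot (xi n y) (xi j y)).
  by rewrite sumr_ge0.
set a := \sum_(y <- F) _; set b := 2^-1 ^+ j.+1 => a0 ab.
have b0 : 0 <= b by rewrite exprn_ge0.
have b1 : b <= 1 by rewrite exprn_ile1//; lra.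
apply: (@le_trans _ _ ((e * b) ^+ 2)).
  by rewrite ler_sqr ?nnegrE// mulr_ge0// ltW.
by rewrite exprMn ler_wpM2l ?sqr_ge0// expr2 ler_piMr.
Qed.

(** The [n]th term of [S] is |xi'_n><xi_n|, whose matrix coefficients tested on [xi n] and [xi' n]
    are the products of the masses. *)
Lemma schur_form_main n : schur_form F k (xi n) (xi' n) S =
  schur_form F k (xi n) (xi' n) (U \o Tn n \o V) +
  \sum_(y <- F) \sum_(y' <- F) k y y' * (sqnorm (xi n y) * sqnorm (xi' n y')).
Proof.
rewrite /schur_form -big_split/=; apply: eq_bigr => y _.
rewrite -big_split/=; apply: eq_bigr => y' _; rewrite -mulrDr; congr (_ * _).
rewrite /S/= (T_split n) (linD U_lin) /rdot dotDl raddfD/=; congr (_ + _).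
rewrite -l2dot_singler -(l2dot_adj UV) -/(xi n) l2dot_single.
rewrite (linZ (single_linear (H := H) _)) (linZ U_lin) -/(xi' n) dotZl/= l2dot_singler.
by rewrite !dotE !hdotE -rmorphM.
Qed.

End partition.

(* The forms [schur_form F w] of [S] and of its finite propagation approximant
   [S'] are compared for the weights [1] and [k]: [B2] and [B3] pass from [S] to
   [S'] at weight [1], [B4] changes the weight, where finite propagation is used,
   [B5] returns to [S], and [B6] discards the terms of [S] other than the [n]th. *)
Lemma key_estimate : exists s, forall n, near_mass (xi n) (xi' n) s (1 - 6 * e).
Proof.
have SR : roe Y H S by case: UV => _ _ _ _; apply.
have [_ /(_ _ e0)[S' [[S'_lin [M0 S'M0]] [s' s'0 S's'] _] SS']] := SR.
pose M := `|M0|.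
have S'M f : l2norm (S' f) <= M * l2norm f.
  by apply: le_trans (S'M0 f) _; rewrite ler_wpM2r ?l2norm_ge0// ler_norm.
have [N FN] := bounded_geometry_sum Y_bounded (ltW s'0).
(* Chosen so that the bound [e' * M * N] of [schur_form_band] is at most [e]. *)
pose e' := e / (M * N%:R + 1).
have MN : 0 <= M * N%:R by apply: mulr_ge0; [exact: normr_ge0|exact: ler0n].
have e'0 : 0 < e' by rewrite divr_gt0// ltr_wpDl.
have e'MN : e' * M * N%:R <= e.
  rewrite -mulrA /e' mulrAC ler_pdivrMr ?ltr_wpDl// ler_wpM2l ?(ltW e0)//; lra.
(* Property A is used at the propagation [s'] of the approximant, so that [k] is nearly [1] on its
   band. *)
have [phi [s [s0 phi0 phis phiF]]] := property_A_partition Y_A s'0 e'0.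
exists s => n.
have [F1 F1P] := fsupp_approx (xi n) (exprn_gt0 2 e0).
have [F2 F2P] := fsupp_approx (xi' n) (exprn_gt0 2 e0).
pose F := (F1 `|` F2)%fset; exists F.
have {}F1P := F1P F (fsubsetUl _ _); have {}F2P := F2P F (fsubsetUr _ _).
have [J [phiJ phie]] := phiF F.
pose k y y' := \sum_(i <- J) phi i y * phi i y'.
pose eta := fsupp F (xi n); pose eta' := fsupp F (xi' n).
have eta1 : l2sq eta <= 1 by rewrite l2sq_fsupp -(xi_sq n) sum_le_l2sq.
have eta'1 : l2sq eta' <= 1 by rewrite l2sq_fsupp -(xi'_sq n) sum_le_l2sq.
have SS'sq f : l2sq (S f - S' f) <= e ^+ 2 * l2sq f.
  by apply: l2sq_le_norm; [exact: ltW|exact: SS'].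
have SS'_lin : linear (fun f => S f - S' f).
  by move=> a f g; rewrite S_lin S'_lin scalerBr opprD addrACA.
have S'S_lin : linear (fun f => S' f - S f).
  by move=> a f g; rewrite S_lin S'_lin scalerBr opprD addrACA.
have B1 : rdot (S (xi n)) (xi' n) = 1.
  by rewrite S_xi /rdot l2dotE xi'_sq.
have B2 : 1 - 2 * e <= rdot (S eta) eta'.
  have h1 : rdot (S (xi n - eta)) (xi' n) <= e.
    apply: rdot_le => //; last by rewrite xi'_sq.
    exact: le_trans (S_l2sq _) (ltW F1P).
  have h2 : rdot (S eta) (xi' n - eta') <= e.
    rewrite /rdot l2dotC Re_conjc; apply: rdot_le => //; first exact: ltW.
    exact: le_trans (S_l2sq _) eta1.
  move: h1 h2 B1; rewrite (linB S_lin) /rdot dotBl dotBr !raddfB/=; lra.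
have B3 : schur_form F (fun _ _ => 1) (xi n) (xi' n) (fun f => S f - S' f) <= e.
  rewrite schur_form1//; apply: rdot_le => //; apply: le_trans (SS'sq _) _.
  by rewrite ler_piMr ?sqr_ge0.
have B4 : schur_form F (fun y y' => 1 - k y y') (xi n) (xi' n) S' <= e.
  apply: le_trans e'MN; apply: (schur_form_band _ (ltW e'0) S'M S's' (FN F)).
  - by rewrite normr_ge0.
  - move=> y y' yF y'F yy'; rewrite subr_ge0 (kernel_le1 phiJ)//=.
    by have := phie _ _ yF y'F yy'; rewrite /k; lra.
  - by rewrite xi_sq.
  - by rewrite xi'_sq.
have B5 : schur_form F k (xi n) (xi' n) (fun f => S' f - S f) <= e.
  apply: (schur_form_le phi0 phiJ) => //; last by rewrite xi'_sq.
  apply: (@le_trans _ _ (\sum_(i <- J) e ^+ 2 * l2sq (localize phi F i (xi n)))).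
    apply: ler_sum => i _; apply: le_trans (SS'sq _).
    by rewrite -[leLHS]l2dot_sq -opprB -scaleN1r dotsqZ l2dot_sq /cmod normrN1 expr1n mul1r.
  rewrite -mulr_sumr (sum_localize phi0 phiJ) ler_piMr ?sqr_ge0//.
  by rewrite -(xi_sq n) sum_le_l2sq.
have B6 : schur_form F k (xi n) (xi' n) (U \o Tn n \o V) <= e.
  apply: (schur_form_le phi0 phiJ) => //; last by rewrite xi'_sq.
  exact: cross_terms.
have B7 := schur_form_main phi F J n.
(* Two losses of [e] come from the truncations in [B2], and one from each of [B3], [B4], [B5] and
   [B6]. *)
have B8 : 1 - 6 * e <= \sum_(y <- F) \sum_(y' <- F) k y y' * (sqnorm (xi n y) * sqnorm (xi' n y')).
  move: B3 B4 B5; rewrite !schur_formB schur_form_weightB.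
  rewrite (schur_form1 _ _ _ S_lin) (schur_form1 _ _ _ S'_lin) -/eta -/eta'; lra.
apply: le_trans B8 _.
rewrite big_seq [leRHS]big_seq; apply: ler_sum => y yF.
rewrite [leRHS]big_mkcond/= big_seq [leRHS]big_seq; apply: ler_sum => y' y'F.
case: ifPn => [_|].
  by apply: ler_piMl; [apply: mulr_ge0; exact: sqnorm_ge0|exact: (kernel_le1 phiJ yF y'F)].
move=> yy'; rewrite /k big1 ?mul0r// => i _.
apply/eqP; rewrite eq_le mulr_ge0// andbT leNgt; apply/negP => /phis.
by apply/negP.
Qed.

End key_estimate.

(** * The coarse equivalence *)

Section near_mass_lemmas.
Context {R : realType} (Z : metricType R) (H : hilbertType R).
Implicit Types (f g : l2 Z H).

Lemma near_mass_mono f g (s s' t : R) : s <= s' ->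
  near_mass f g s t -> near_mass f g s' t.
Proof.
move=> ss' [F tF]; exists F; apply: le_trans tF _; apply: ler_sum => y _.
rewrite big_mkcond [leRHS]big_mkcond; apply: ler_sum => y' _.
case: ifPn => [h|_]; first by rewrite (le_trans h).
by case: ifP => // _; apply: mulr_ge0; exact: sqnorm_ge0.
Qed.

Lemma near_mass_exists f g (t : R) : l2sq f = 1 -> l2sq g = 1 -> t < 1 ->
  exists s, near_mass f g s t.
Proof.
(* Both families keep mass above [1 - d] on a finite set, and the square of [1 - d] is at least
   [1 - 2 * d = t]. The sum of all distances in that set then serves as radius. *)
move=> f1 g1 t1; pose d := (1 - t) / 2.
have d0 : 0 < d by rewrite divr_gt0// subr_gt0.
have [F fF] := l2sq_approx f d0; have [G gG] := l2sq_approx g d0.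
pose A := (F `|` G)%fset.
exists (\sum_(y <- A) \sum_(y' <- A) mdist y y'), A.
have fA : 1 - d < \sum_(y <- A) sqnorm (f y).
  rewrite -f1; apply: lt_le_trans fF _.
  by apply: ler_sum_fsubset (fsubsetUl _ _) => y; exact: sqnorm_ge0.
have gA : 1 - d < \sum_(y <- A) sqnorm (g y).
  rewrite -g1; apply: lt_le_trans gG _.
  by apply: ler_sum_fsubset (fsubsetUr _ _) => y; exact: sqnorm_ge0.
apply: (@le_trans _ _ ((\sum_(y <- A) sqnorm (f y)) * (\sum_(y <- A) sqnorm (g y)))).
  have := sum_le_l2sq f A; have := sum_le_l2sq g A; rewrite f1 g1.
  move: fA gA; set a := \sum_(y <- A) sqnorm (f y); set b := \sum_(y <- A) sqnorm (g y).
  have a0 : 0 <= a by apply: sumr_ge0 => y _; exact: sqnorm_ge0.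
  have b0 : 0 <= b by apply: sumr_ge0 => y _; exact: sqnorm_ge0.
  by rewrite /d; nra.
rewrite big_distrlr/= big_seq [leRHS]big_seq; apply: ler_sum => y yA.
rewrite [leRHS]big_mkcond/= big_seq [leRHS]big_seq; apply: ler_sum => y' y'A.
rewrite ifT// (big_fsetD1 y)//= (big_fsetD1 y')//= -addrA lerDl addr_ge0//.
  by apply: sumr_ge0 => *; exact: mdist_ge0.
by apply: sumr_ge0 => *; apply: sumr_ge0 => *; exact: mdist_ge0.
Qed.

(** For the product measure on pairs, the event of being [s]-close and the event [G] times [G'] have
    total mass above [1], so they intersect. *)
Lemma near_mass_hit f g (s t : R) (G G' : {fset Z}) :
  l2sq f <= 1 -> l2sq g <= 1 -> near_mass f g s t ->
  1 - t < (\sum_(y <- G) sqnorm (f y)) * (\sum_(y <- G') sqnorm (g y)) ->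
  exists y y', [/\ y \in G, y' \in G' & mdist y y' <= s].
Proof.
move=> f1 g1 [F tF] tG; apply: contrapT => noyy'.
pose A := (F `|` (G `|` G'))%fset.
pose m y y' := sqnorm (f y) * sqnorm (g y').
have m0 y y' : 0 <= m y y' by apply: mulr_ge0; exact: sqnorm_ge0.
have h1 : \sum_(y <- F) \sum_(y' <- F | mdist y y' <= s) m y y' <=
    \sum_(y <- A) \sum_(y' <- A) (mdist y y' <= s)%R%:R * m y y'.
  apply: (@le_trans _ _ (\sum_(y <- F) \sum_(y' <- A) (mdist y y' <= s)%R%:R * m y y')).
    apply: ler_sum => y _.
    have -> : \sum_(y' <- F | mdist y y' <= s) m y y' =
        \sum_(y' <- F) (mdist y y' <= s)%R%:R * m y y'.
      by rewrite big_mkcond/=; apply: eq_bigr => y' _; case: ifP; rewrite ?mul1r ?mul0r.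
    by apply: ler_sum_fsubset (fsubsetUl _ _) => y'; exact: mulr_ge0.
  apply: ler_sum_fsubset (fsubsetUl _ _) => y.
  by apply: sumr_ge0 => y' _; exact: mulr_ge0.
have h2 : (\sum_(y <- G) sqnorm (f y)) * (\sum_(y <- G') sqnorm (g y)) <=
    \sum_(y <- A) \sum_(y' <- A) ((y \in G) && (y' \in G'))%:R * m y y'.
  rewrite big_distrlr/=.
  apply: (@le_trans _ _ (\sum_(y <- G) \sum_(y' <- A)
      ((y \in G) && (y' \in G'))%:R * m y y')).
    rewrite big_seq [leRHS]big_seq; apply: ler_sum => y yG.
    apply: (@le_trans _ _ (\sum_(y' <- G') ((y \in G) && (y' \in G'))%:R * m y y')).
      rewrite big_seq [leRHS]big_seq; apply: ler_sum => y' y'G.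
      by rewrite yG y'G mul1r.
    apply: ler_sum_fsubset => [y'|]; first exact: mulr_ge0.
    by apply: fsubset_trans (fsubsetUr F _); exact: fsubsetUr.
  apply: ler_sum_fsubset => [y|]; first by apply: sumr_ge0 => y' _; exact: mulr_ge0.
  by apply: fsubset_trans (fsubsetUr F _); exact: fsubsetUl.
have h3 : \sum_(y <- A) \sum_(y' <- A) (mdist y y' <= s)%R%:R * m y y' +
    \sum_(y <- A) \sum_(y' <- A) ((y \in G) && (y' \in G'))%:R * m y y' <= 1.
  rewrite -big_split/=.
  apply: (@le_trans _ _ (\sum_(y <- A) \sum_(y' <- A) m y y')).
    apply: ler_sum => y _; rewrite -big_split/=; apply: ler_sum => y' _.
    rewrite -mulrDl ler_piMl// -natrD lern1.
    case: (boolP (_ && _)) => [/andP[yG y'G]|_]; last by rewrite addn0 leq_b1.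
    case: leP => // yy'; exfalso; apply: noyy'.
    by exists y, y'.
  rewrite -big_distrlr/=.
  apply: mulr_ile1.
  - by apply: sumr_ge0 => y _; exact: sqnorm_ge0.
  - by apply: sumr_ge0 => y _; exact: sqnorm_ge0.
  - exact: le_trans (sum_le_l2sq _ _) f1.
  - exact: le_trans (sum_le_l2sq _ _) g1.
move: tF tG h1 h2 h3; rewrite /m; lra.
Qed.

(** Averaging against the masses of [f]: if [g] had mass below [t'] near every [y], the near mass
    would be at most [t']. *)
Lemma near_mass_concentrated f g (s t t' : R) : l2sq f <= 1 -> 0 <= t' < t ->
  near_mass f g s t -> exists y (G : {fset Z}),
    (forall z, z \in G -> mdist y z <= s) /\ t' <= \sum_(z <- G) sqnorm (g z).
Proof.
move=> f1 /andP[t'0 t't] [F tF]; apply: contrapT => noy.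
have : \sum_(y <- F) \sum_(y' <- F | mdist y y' <= s) sqnorm (f y) * sqnorm (g y') <= t'.
  apply: (@le_trans _ _ (\sum_(y <- F) sqnorm (f y) * t')).
    apply: ler_sum => y _; rewrite -mulr_sumr ler_wpM2l ?sqnorm_ge0//.
    rewrite leNgt; apply/negP => ty; apply: noy.
    exists y, [fset z in F | mdist y z <= s]%fset; split.
      by move=> z; rewrite !inE/= => /andP[].
    apply: ltW; apply: lt_le_trans ty _; rewrite -big_filter le_eqVlt; apply/orP; left.
    apply/eqP; apply: perm_big; apply: uniq_perm; rewrite ?filter_uniq ?fset_uniq//.
    by move=> z; rewrite mem_filter !inE/= andbC.
  rewrite -mulr_suml ler_piMl//; exact: le_trans (sum_le_l2sq _ _) f1.
by apply/negP; rewrite -ltNge; apply: lt_le_trans tF.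
Qed.

End near_mass_lemmas.

(** * Maps to the centres of concentration *)

Section coarse_maps.
Context {R : realType} (X Y : metricType R) (H : hilbertType R).
Variables (U : l2 X H -> l2 Y H) (V : l2 Y H -> l2 X H).
Hypothesis UV : roe_unitary U V.
Hypotheses (X_bounded : bounded_geometry X) (Y_bounded : bounded_geometry Y).
Hypothesis Y_A : property_A Y.

(** Escaping sequences are thinned until the points are distinct and the overlaps summable. The
    choice [d = (1 - t) / 6] absorbs the loss [6 * d] of [key_estimate]. *)
Lemma near_mass_subsequence (x x' : nat -> X) (v v' : nat -> H) (r t : R) :
  escapes x -> escapes x' -> (forall n, mdist (x' n) (x n) <= r) ->
  (forall n, sqnorm (v n) = 1) -> (forall n, sqnorm (v' n) = 1) -> t < 1 ->
  exists (s : R) (e : nat -> nat), (forall k, (k <= e k)%N) /\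
    forall k, near_mass (U (single (x (e k)) (v (e k))))
                        (U (single (x' (e k)) (v' (e k)))) s t.
Proof.
move=> ex ex' xr v1 v'1 t1.
pose d := (1 - t) / 6; have d0 : 0 < d by rewrite divr_gt0// subr_gt0.
pose xi n := U (single (x n) (v n)).
pose Q k m n := [/\ x n != x m, x' n != x' m & forall F : {fset Y},
  \sum_(y <- F) cmod (hdot (xi m y) (xi n y)) <= d * 2^-1 ^+ k.+1].
have [k m|e [ke eQ]] := @subsequence Q.
  have h1 := ex (x m); have h2 := ex' (x' m).
  have v1' n : sqnorm (v n) <= 1 by rewrite v1.
  have d2 : 0 < d * 2^-1 ^+ k.+1 by rewrite mulr_gt0// exprn_gt0.
  have h3 := overlap_null UV (xi m) ex v1' d2.
  by near=> n; split; near: n.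
have inj (z : nat -> X) : (forall j k, (j < k)%N -> z (e k) != z (e j)) ->
    injective (z \o e).
  move=> zQ i j /= zij; case: (ltngtP i j) => // [/zQ|/zQ]; by rewrite zij eqxx.
have [] := @key_estimate _ X Y H U V UV Y_bounded Y_A (x \o e) (x' \o e) (v \o e)
    (v' \o e) r d.
- by apply: inj => j k /eQ[].
- by apply: inj => j k /eQ[].
- by move=> n; exact: xr.
- by move=> n; exact: v1.
- by move=> n; exact: v'1.
- by [].
- move=> n k F; rewrite neq_ltn => /orP[kn|nk]; last by have [_ _] := eQ _ _ nk; apply.
  (* The subsequence controls overlaps with later vectors only; the other order follows by symmetry,
     the bound with the larger exponent being the smaller one. *)
  have [_ _ /(_ F) h] := eQ _ _ kn.
  under eq_bigr do rewrite dotC cmod_conj.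
  apply: le_trans h _; rewrite ler_wpM2l ?(ltW d0)//.
  apply: ler_wiXn2l; first by rewrite invr_ge0.
    by rewrite invf_le1// ler1n.
  by rewrite ltnS ltnW.
move=> s sP; exists s, e; split=> // k; have := sP k.
by have -> : 1 - 6 * d = t by rewrite /d; lra.
Unshelve. all: by end_near. Qed.

Variable h0 : H.
Hypothesis h01 : sqnorm h0 = 1.

(** Pairs failing at radius [n] must escape, since every fixed pair succeeds for large [n]. A
    subsequence then has one common radius, a contradiction at large indices. *)
Lemma near_pairs (r t : R) : 0 <= r -> t < 1 ->
  exists s, forall x x' : X, mdist x x' <= r ->
    near_mass (U (single x h0)) (U (single x' h0)) s t.
Proof.
move=> r0 t1; apply: contrapT => noS.
have bad n : exists xx : X * X, mdist xx.1 xx.2 <= r /\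
    ~ near_mass (U (single xx.1 h0)) (U (single xx.2 h0)) n%:R t.
  apply: contrapT => good; apply: noS; exists n%:R => x x' xr.
  by apply: contrapT => nm; apply: good; exists (x, x').
have [xx xxP] := choice bad.
have sq1 p : l2sq (U (single p h0)) = 1 by rewrite (unitary_l2sq UV) l2sq_single.
have ev p q : \forall n \near \oo,
    near_mass (U (single p h0)) (U (single q h0)) n%:R t.
  have [s sP] := near_mass_exists (sq1 p) (sq1 q) t1.
  near=> n; apply: near_mass_mono sP; near: n.
  exact: nbhs_infty_ger.
have [N GP] := bounded_geometry_fset X_bounded r0.
(* When the first point is [p], the second lies in the finite ball around [p], and from some [n] on
   no such pair fails. *)
have e1 : escapes (fun n => (xx n).1).
  move=> p; have [G _ Gball] := GP p.
  have := @near_fset _ G (fun q n => near_mass (U (single p h0)) (U (single q h0)) n%:R t)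
    (fun q _ => ev p q).
  apply: filterS => n h; apply/eqP => xp; have [xr []] := xxP n.
  by rewrite xp; apply: h; rewrite Gball -xp.
have e2 : escapes (fun n => (xx n).2).
  move=> p; have [G _ Gball] := GP p.
  have := @near_fset _ G (fun q n => near_mass (U (single q h0)) (U (single p h0)) n%:R t)
    (fun q _ => ev q p).
  apply: filterS => n h; apply/eqP => xp; have [xr []] := xxP n.
  by rewrite xp; apply: h; rewrite Gball -xp metric_sym.
have dr n : mdist (xx n).2 (xx n).1 <= r by rewrite metric_sym; case: (xxP n).
have [s [e [ke nm]]] := near_mass_subsequence e1 e2 dr (fun=> h01) (fun=> h01) t1.
have [k sk] : exists k : nat, s <= k%:R.
  by exists (Num.truncn `|s|).+1; rewrite (le_trans (ler_norm _))// ltW// truncnS_gt.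
have [_] := xxP (e k); apply; apply: near_mass_mono (nm k).
by apply: le_trans sk _; rewrite ler_nat.
Unshelve. all: by end_near. Qed.

(** The constant must satisfy two inequalities: its square exceeds [1 / 4] in [tracks_expansive],
    and it exceeds [1 / 2] in [tracks_close]. *)
Definition tracks (f : X -> Y) (s : R) := forall x, exists G : {fset Y},
  (forall z, z \in G -> mdist (f x) z <= s) /\
  3 / 4 <= \sum_(z <- G) sqnorm (U (single x h0) z).

Lemma tracks_exists : exists f s, tracks f s.
Proof.
(* Each point is paired with itself; [7 / 8] leaves the strict gap to [3 / 4] required by
   [near_mass_concentrated]. *)
have [|s sP] := @near_pairs 0 (7 / 8) (lexx _); first by lra.
have : forall x, exists y, exists G : {fset Y},
  (forall z, z \in G -> mdist y z <= s) /\
  3 / 4 <= \sum_(z <- G) sqnorm (U (single x h0) z).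
  move=> x; have xx : mdist x x <= 0 by rewrite mdistxx.
  have x1 : l2sq (U (single x h0)) <= 1 by rewrite (unitary_l2sq UV) l2sq_single h01.
  have t34 : ((0 : R) <= 3 / 4) && ((3 / 4 : R) < 7 / 8).
    by rewrite divr_ge0 //=; lra.
  exact: near_mass_concentrated x1 t34 (sP x x xx).
by move=> /choice[f fP]; exists f, s.
Qed.

Lemma tracks_expansive f s : tracks f s -> uniformly_expansive f.
Proof.
move=> fs r r0; have t1 : 3 / 4 < 1 :> R by lra.
have [s' s'P] := near_pairs (ltW r0) t1.
exists (`|s| + `|s'| + `|s| + 1); first by rewrite ltr_wpDl// !addr_ge0.
move=> x x' xr; have [G [Gs Gm]] := fs x; have [G' [G's G'm]] := fs x'.
have sq1 p : l2sq (U (single p h0)) <= 1 by rewrite (unitary_l2sq UV) l2sq_single h01.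
(* The product of the two masses is at least [9 / 16], above [1 - 3 / 4]. *)
have [|y [y' [yG y'G yy']]] := near_mass_hit (G := G) (G' := G') (sq1 x) (sq1 x') (s'P _ _ xr).
  by nra.
have := metric_triangle (f x) y (f x'); have := metric_triangle y y' (f x').
have := Gs _ yG; have := G's _ y'G; rewrite [mdist _ y']metric_sym.
have := ler_norm s; have := ler_norm s'; lra.
Qed.

End coarse_maps.

(** * Compact coefficients and their vanishing along escaping sequences *)

Section compactness.
Context {R : realType} (H : hilbertType R).

Lemma compact_net (A : set H) (d : R) : compact A -> 0 < d ->
  exists F : {fset H}, forall a, A a -> exists2 z, z \in F & sqnorm (a - z) <= d ^+ 2.
Proof.
rewrite compact_cover => cA d0.
have dc0 : 0 < d%:C by rewrite ltcR.
have [|a Aa|F _ AF] := cA H A (fun z => ball z d%:C).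
- by move=> z _; exact: ball_open.
- by exists a => //; exact: ballxx.
exists F => a /AF[z /= zF].
rewrite -ball_normE/= => az; exists z => //.
rewrite /sqnorm distrC ler_sqr ?nnegrE; last 2 first.
- by have := normr_ge0 (z - a); rewrite normHE lecR.
- exact: ltW.
by move: az; rewrite normHE ltcR => /ltW.
Qed.

Lemma compact_operator_net (T : H -> H) (d : R) : compact_operator T -> 0 < d ->
  exists F : {fset H}, forall v, sqnorm v <= 1 ->
    exists2 z, z \in F & sqnorm (T v - z) <= d ^+ 2.
Proof.
move=> [_ /compact_net cT] d0; have [F FP] := cT _ d0.
exists F => v v1; apply: FP; apply: subset_closure; exists v => //=.
rewrite normHE -[1]/(1%:C) lecR.
have : 0 <= complex.Re `|v| by have := normr_ge0 v; rewrite normHE lecR.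
by move: v1; rewrite /sqnorm => v1 v0; rewrite -(@expr_le1 _ 2).
Qed.

Lemma cmod_hdot_le (u w : H) (d : R) : 0 <= d -> sqnorm u <= d ^+ 2 ->
  sqnorm w <= 1 -> cmod (hdot u w) <= d.
Proof.
move=> d0 ud w1; rewrite -ler_sqr ?nnegrE ?cmod_ge0//.
apply: le_trans (cauchy_schwarz _ _ _) _; rewrite !hdotE.
by have := sqnorm_ge0 u; have := sqnorm_ge0 w; nra.
Qed.

End compactness.

Section vanishing_coefficients.
Context {R : realType} (X Y : metricType R) (H : hilbertType R).
Variables (U : l2 X H -> l2 Y H) (V : l2 Y H -> l2 X H).
Hypothesis UV : roe_unitary U V.
Variable h0 : H.
Hypothesis h01 : sqnorm h0 = 1.

Lemma l2dot_eq0 (Z : choiceType) (f g : l2 Z H) :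
  (forall z, hdot (f z) (g z) = 0) -> l2dot f g = 0.
Proof.
move=> fg; apply: l2dot_unique.
rewrite [X in fmap X _](_ : _ = fun=> 0 : R[i]^o); first exact: cvg_cst.
by apply/funext => F; rewrite big1.
Qed.

(** The projection onto l2(X) tensor [h0]: it fixes every [single x h0] and has propagation zero. *)
Let P : l2 X H -> l2 X H := transl Some id (fun=> h0) (fun=> h0).

Let P_data : transl_data (@Some X) id (fun=> h0) (fun=> h0).
Proof.
by split => [z z' j [->] [->] //|z z' //|j|j]; rewrite h01.
Qed.

Let PE g z : P g z = hdot (g z) h0 *: h0.
Proof. by rewrite (translE P_data). Qed.

Let hdot_h0 : hdot h0 h0 = 1. Proof. by rewrite dotE hdotE h01. Qed.

Let P_form g : l2dot (P g) g = (l2sq (P g))%:C.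
Proof.
rewrite -l2dotE; apply/eqP; rewrite -subr_eq0 -dotBr; apply/eqP/l2dot_eq0 => z.
rewrite l2D l2N PE dotBr !dotZl dotZr hdot_h0 mulr1.
by rewrite (dotC hdot h0) subrr.
Qed.

(* The diagonal coefficient at [y] of the image of [P] is compact, while its
   quadratic form at [(U e_n) y] is at least [sqnorm ((U e_n) y) ^+ 2], where
   [(U e_n) y] tends weakly to [0]. *)
Lemma coefficient_vanishes (x : nat -> X) (y : Y) (c : R) : escapes x -> 0 < c ->
  \forall n \near \oo, sqnorm (U (single (x n) h0) y) < c.
Proof.
move=> ex c0.
have PR : roe X H P.
  apply: algebraic_roe_roe; apply: (@transl_roe _ _ _ _ _ _ _ _ P_data 0).
  by move=> z j [->]; rewrite mdistxx.
have [_ _ _ _ /(_ _ PR)[_]] := UV; set Q := U \o P \o V => QR.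
(* Compactness and weak convergence bound the form of [S] by [2 * d], and passing from [Q] to [S]
   costs [d]; the total [3 * d] is below the lower bound [c ^+ 2]. *)
have d0 : 0 < c ^+ 2 / 4 by rewrite divr_gt0// exprn_gt0.
set d := c ^+ 2 / 4 in d0.
have [S [_ _ /(_ y y) Sc] QS] := QR _ d0.
have [F FP] := compact_operator_net Sc d0.
have h1 : forall n : nat, sqnorm h0 <= 1 by move=> _; rewrite h01.
have : \forall n \near \oo, forall z, z \in F ->
    cmod (l2dot (single y z) (U (single (x n) h0))) <= d.
  by apply: near_fset => z _; exact: (unitary_weakly_null UV (v := fun=> h0) (single y z) ex h1 d0).
clear h1; apply: filterS => n nF; rewrite ltNge; apply/negP.
set xi := U _ in nF *; set w := xi y => cw.
have w1 : sqnorm w <= 1.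
  by apply: le_trans (sqnorm_le_l2sq xi y) _; rewrite (unitary_l2sq UV) l2sq_single h01.
have [z zF Kz] := FP w w1.
have zw : cmod (hdot z w) <= d by have := nF z zF; rewrite l2dot_single.
have Kw : complex.Re (hdot (matrix_coef S y y w) w) <= 2 * d.
  rewrite -(subrK z (matrix_coef S y y w)) dotDl raddfD/=.
  rewrite mulr_natl mulr2n; apply: lerD.
    exact: le_trans (le_Re_cmod _) (cmod_hdot_le (ltW d0) Kz w1).
  exact: le_trans (le_Re_cmod _) zw.
pose e := single y w : l2 Y H.
have QSe : rdot (Q e - S e) e <= d.
  apply: rdot_le => //; last by rewrite l2sq_single.
  apply: le_trans (l2sq_le_norm (ltW d0) (QS e)) _.
  by rewrite l2sq_single ler_piMr ?sqr_ge0.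
have Qe : c ^+ 2 <= rdot (Q e) e.
  have [_ _ UK iso _] := UV.
  rewrite /rdot /Q/= -[X in l2dot _ X](UK e) iso P_form/=.
  (* Only the component of [P (V e)] at [x n] is kept; its norm is the modulus of <e, xi>, which
     equals [sqnorm w]. *)
  apply: le_trans (sqnorm_le_l2sq _ (x n)).
  rewrite PE -hdotE dotsqZ hdotE h01 mulr1 -l2dot_singler -(l2dot_adj UV) -/xi.
  rewrite l2dot_single -/w dotE cmodR ?dotsq_ge0// hdotE.
  by rewrite ler_sqr ?nnegrE ?sqnorm_ge0// ltW.
have Se : l2dot (S e) e = hdot (matrix_coef S y y w) w by rewrite l2dot_singler.
have c2 : 0 < c ^+ 2 by rewrite exprn_gt0.
move: QSe Qe Kw; rewrite /rdot dotBl raddfB/= Se /d; lra.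
Qed.

End vanishing_coefficients.

(** * The composites are close to the identity *)

Section close_to_identity.
Context {R : realType} (X Y : metricType R) (H : hilbertType R).
Variables (U : l2 X H -> l2 Y H) (V : l2 Y H -> l2 X H).
Hypotheses (UV : roe_unitary U V) (VU : roe_unitary V U).
Hypotheses (X_bounded : bounded_geometry X) (Y_bounded : bounded_geometry Y).
Hypothesis X_A : property_A X.
Variable h0 : H.
Hypothesis h01 : sqnorm h0 = 1.

Lemma unit_direction (w : H) : w != 0 ->
  exists2 u, sqnorm u = 1 & cmod (hdot u w) ^+ 2 = sqnorm w.
Proof.
move=> w0; set a := sqnorm w.
have a0 : 0 < a.
  rewrite lt_neqAle sqnorm_ge0 andbT eq_sym; apply: contra_neq w0 => aw.
  by apply: (@dotsq_eq0 _ _ hdot); rewrite hdotE.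
have sa : Num.sqrt a ^+ 2 = a by rewrite sqr_sqrtr// ltW.
have sa0 : 0 < Num.sqrt a by rewrite sqrtr_gt0.
exists ((Num.sqrt a)^-1%:C *: w).
  by rewrite -hdotE dotsqZ hdotE cmodR ?invr_ge0 ?(ltW sa0)// exprVn sa mulVf// gt_eqF.
rewrite dotZl cmodM cmodR ?invr_ge0 ?(ltW sa0)// dotE hdotE cmodR ?sqnorm_ge0//.
by rewrite exprMn exprVn sa expr2 mulrA mulVf ?mul1r// gt_eqF.
Qed.

(** Otherwise some [x n] are arbitrarily far from [g (f (x n))]. The image under [V] of a vector at
    a point near [f (x n)] has mass at least [c] at [x n], that of [h0] at [f (x n)] sits near
    [g (f (x n))], and the near mass estimate for this pair brings the two places together. *)
Lemma tracks_close (f : X -> Y) (g : Y -> X) (s0 s1 : R) :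
  tracks U h0 f s0 -> tracks V h0 g s1 -> close_maps (g \o f) idfun.
Proof.
move=> fs gs; apply: contrapT => far.
have /choice[x xP] : forall n : nat, exists x, n%:R + 1 < mdist (g (f x)) x.
  move=> n; apply: contrapT => nx; apply: far; exists (n%:R + 1); first by rewrite ltr_wpDl.
  by move=> x; rewrite leNgt; apply/negP => h; apply: nx; exists x.
have large (a : R) : \forall n \near \oo, a <= n%:R by exact: nbhs_infty_ger.
have ex : escapes x.
  move=> p; have := large (mdist (g (f p)) p); apply: filterS => n hn; apply/eqP => xp.
  by have := xP n; rewrite xp; lra.
have [N NP] := bounded_geometry_fset Y_bounded (normr_ge0 s0).
(* By pigeonhole, mass [3 / 4] spread over at most [N] points leaves at least [c] at one of them;
   [N + 1] makes the count strict. *)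
pose c : R := 3 / (4 * (N%:R + 1)).
have N1 : 0 < N%:R + 1 :> R by rewrite ltr_wpDl.
have c0 : 0 < c by rewrite divr_gt0// mulr_gt0.
have cN : c * (N%:R + 1) = 3 / 4.
  by rewrite /c invfM mulrA divfK// gt_eqF.
pose xi n := U (single (x n) h0).
have /choice[y' y'P] : forall n, exists y', mdist (f (x n)) y' <= s0 /\ c <= sqnorm (xi n y').
  move=> n; apply: contrapT => ny'; have [G [Gs Gm]] := fs (x n).
  have [B BN BP] := NP (f (x n)).
  have GB : (G `<=` B)%fset.
    by apply/fsubsetP => z /Gs zs; rewrite BP (le_trans zs)// ler_norm.
  have : \sum_(z <- G) sqnorm (xi n z) <= c * N%:R.
    apply: (@le_trans _ _ (\sum_(z <- G) c)).
      rewrite big_seq [leRHS]big_seq; apply: ler_sum => z zG.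
      by rewrite leNgt; apply/negP => h; apply: ny'; exists z; split; [exact: Gs|exact: ltW].
    rewrite big_const_seq count_predT iter_addr_0 -[c *+ _]mulr_natr ler_wpM2l ?(ltW c0)//.
    by rewrite ler_nat (leq_trans _ BN)// fsubset_leq_card.
  move: Gm; rewrite -/(xi n) -cN; nra.
have /choice[u uP] : forall n, exists u,
    sqnorm u = 1 /\ cmod (hdot u (xi n (y' n))) ^+ 2 = sqnorm (xi n (y' n)).
  move=> n; have [_ cy] := y'P n.
  have w0 : xi n (y' n) != 0.
    by apply/eqP => w0; move: cy; rewrite w0 /sqnorm normr0 expr0n/= leNgt c0.
  by have [u u1 uw] := unit_direction w0; exists u.
have ey' : escapes y'.
  move=> p; have := coefficient_vanishes UV h01 p ex c0; apply: filterS => n.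
  by apply: contraTneq => <-; rewrite -leNgt; case: (y'P n).
(* If [f (x n)] is [p], then [y' n] lies in a fixed finite ball, on which the masses eventually fall
   below [c]. *)
have ey : escapes (f \o x).
  move=> p; have [B _ BP] := NP p.
  have := @near_fset _ B (fun q n => sqnorm (xi n q) < c)
    (fun q _ => coefficient_vanishes UV h01 q ex c0).
  apply: filterS => n h; apply/eqP => /= fp; have [ys cy] := y'P n.
  have : y' n \in B by rewrite BP -fp (le_trans ys)// ler_norm.
  by move=> /h; rewrite ltNge cy.
(* [near_mass_hit] will compare [c / 2] with the product of the masses, at least [c * (3 / 4)]. *)
have t1 : 1 - c / 2 < 1 by rewrite gtrBl divr_gt0.
have dr n : mdist ((f \o x) n) (y' n) <= s0 by case: (y'P n).
have u1 n : sqnorm (u n) = 1 by case: (uP n).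
have [s [e [ke nm]]] := near_mass_subsequence VU X_bounded X_A ey' ey dr u1 (fun=> h01) t1.
have [k sk] : exists k : nat, s + s1 <= k%:R.
  by exists (Num.truncn `|s + s1|).+1; rewrite (le_trans (ler_norm _))// ltW// truncnS_gt.
set n := e k in ke nm; have [G [Gs Gm]] := gs (f (x n)).
have sq1 (a : Y) (h : H) : sqnorm h = 1 -> l2sq (V (single a h)) <= 1.
  by move=> h1; rewrite (unitary_l2sq VU) l2sq_single h1.
(* By adjunction, pairing [u n] at [y' n] with [xi n] is pairing its image under [V] with [h0] at
   [x n]; the direction [u n] makes the former as large as possible. *)
have mx : c <= sqnorm (V (single (y' n) (u n)) (x n)).
  have [_ cy] := y'P n; have [_ uw] := uP n.
  apply: le_trans cy _; rewrite -uw -l2dot_single (l2dot_adj UV) l2dot_singler.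
  by apply: le_trans (cauchy_schwarz _ _ _) _; rewrite !hdotE h01 mulr1.
have [|a [b []]] := near_mass_hit (G := [fset x n]%fset) (G' := G)
    (sq1 _ _ (u1 n)) (sq1 _ _ h01) (nm k).
  by rewrite big_seq_fset1; move: Gm => /=; nra.
rewrite inE => /eqP -> bG ab; have := Gs _ bG; have := xP n.
have := metric_triangle (g (f (x n))) b (x n); rewrite [mdist b _]metric_sym.
have : k%:R <= n%:R :> R by rewrite ler_nat.
lra.
Qed.

End close_to_identity.

Lemma infinite_dimensional_unit {R : realType} (H : hilbertType R) :
  infinite_dimensional H -> exists h : H, sqnorm h = 1.
Proof.
move=> infH; have [h h0] : exists h : H, h != 0.
  apply: contrapT => noh; apply: infH; exists 0%N, (fun=> 0) => v.
  exists (fun=> 0); rewrite big_ord0; apply/eqP; apply/negPn/negP => v0.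
  by apply: noh; exists v.
by have [u u1 _] := unit_direction h0; exists u.
Qed.

Theorem theorem1p8 (R : realType) (H : hilbertType R) (X Y : metricType R)
    (H_separable : separable H) (H_infinite : infinite_dimensional H)
    (X_bounded : bounded_geometry X) (Y_bounded : bounded_geometry Y)
    (X_A : property_A X) (Y_A : property_A Y)
    (iso : star_isomorphic (roe X H) (roe Y H)) :
  coarsely_equivalent X Y.
Proof.
have [h0 h01] := infinite_dimensional_unit H_infinite.
have [[x0]|X0] := pselect (inhabited X).
  have [U [V [UV VU]]] := star_isomorphism_spatial x0 h01 iso.
  have [f [s fs]] := tracks_exists UV X_bounded Y_bounded Y_A h01.
  have [g [t gt]] := tracks_exists VU Y_bounded X_bounded X_A h01.
  exists f, g; split.
  - exact: (tracks_expansive UV X_bounded Y_bounded Y_A h01 fs).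
  - exact: (tracks_expansive VU Y_bounded X_bounded X_A h01 gt).
  - exact: (tracks_close VU UV Y_bounded X_bounded Y_A h01 gt fs).
  - exact: (tracks_close UV VU X_bounded Y_bounded X_A h01 fs gt).
(* The spatial argument needs a base point. If [X] is empty then so is [Y], and the empty maps
   work. *)
have xF (x : X) : False by exact: X0 (inhabits x).
have yF (y : Y) : False by exact: X0 (star_isomorphic_nonempty h01 iso y).
exists (fun x => False_rect Y (xF x)), (fun y => False_rect X (yF y)).
split.
- by move=> r r0; exists 1 => // x; have := xF x.
- by move=> r r0; exists 1 => // y; have := yF y.
- by exists 1 => // y; have := yF y.
- by exists 1 => // x; have := xF x.
Qed.
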